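(* Let $E$ be a real $d\times d$ matrix whose eigenvalues all have positive real parts, let $a_1>0$ be the smallest real part of the eigenvalues of $E$, let $E^t$ be the transpose of $E$, and let $q=\operatorname{trace}(E)$. Let $\psi:\mathbb{R}^d\to[0,\infty)$ be a continuous, $E^t$-homogeneous function such that $\psi(x)\neq0$ for $x\ne0$. Then for any $0<\alpha\le2$ (and $H\in\mathbb{R}$) the random field $$X_\psi(x)=\operatorname{Re}\int_{\mathbb{R}^d}\Bigl(e^{i\langle x,\xi\rangle}-1\Bigr)\psi(\xi)^{-H-q/\alpha}\,W_\alpha(d\xi),\qquad x\in\mathbb{R}^d,$$ exists and is stochastically continuous if and only if $H\in(0,a_1)$.
   Context: For $c>0$ and a square matrix $A$, $c^A=\exp(A\log c)$ (matrix exponential). A function $\psi$ on $\mathbb{R}^d$ is $E^t$-homogeneous if $\psi(c^{E^t}x)=c\psi(x)$ for all $c>0$ and $x\neq0$. $\langle\cdot,\cdot\rangle$ is the standard inner product. $W_\alpha(d\xi)$ is a complex isotropic symmetric $\alpha$-stable ($S\alpha S$) random measure on $\mathbb{R}^d$ with Lebesgue control measure. For a measurable $f:\mathbb{R}^d\to\mathbb{C}$ the integral $\int f\,dW_\alpha$ exists if and only if $\int_{\mathbb{R}^d}|f(\xi)|^\alpha d\xi<\infty$; it is linear in $f$, and $Y=\operatorname{Re}\int f\,dW_\alpha$ has characteristic function $\mathbb{E}(e^{itY})=\exp(-c_0|t|^\alpha\int|f(\xi)|^\alpha d\xi)$ with a constant $c_0>0$ depending only on $\alpha$. The field exists if the integral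 exists for every $x\in\mathbb{R}^d$. Stochastically continuous means continuous in probability at every $x_0\in\mathbb{R}^d$. *)

(* Defs.v *)
From HB Require Import structures.
From mathcomp Require Import all_boot all_order all_algebra.
From mathcomp Require Import all_classical all_reals all_analysis.
From mathcomp Require Import complex.

Set Implicit Arguments.
Unset Strict Implicit.
Unset Printing Implicit Defensive.

Import Order.TTheory GRing.Theory Num.Theory.
Import numFieldNormedType.Exports.

Local Open Scope classical_set_scope.
Local Open Scope ring_scope.
Local Open Scope complex_scope.

(* Vectors of R^n are columns 'cV[R]_n.  They carry the sigma-algebra generated
   by the coordinate maps, i.e. the Borel sigma-algebra of R^n. *)
Section measurable_cV.
Variables (R : realType) (n : nat).

Let coord (i : 'I_n) (v : 'cV[R]_n) : R := v i ord0.

Let cV_set0 : g_sigma_preimage coord set0.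
Proof. exact: sigma_algebra0. Qed.

Let cV_setC A : g_sigma_preimage coord A -> g_sigma_preimage coord (~` A).
Proof. exact: sigma_algebraC. Qed.

Let cV_bigcup (F : _^nat) : (forall i, g_sigma_preimage coord (F i)) ->
  g_sigma_preimage coord (\bigcup_i (F i)).
Proof. exact: sigma_algebra_bigcup. Qed.

HB.instance Definition _ := @isMeasurable.Build default_measure_display
  'cV[R]_n (g_sigma_preimage coord) cV_set0 cV_setC cV_bigcup.

End measurable_cV.

Lemma measurable_coord (R : realType) n (i : 'I_n) :
  measurable_fun [set: 'cV[R]_n] (fun v => v i ord0).
Proof.
move=> _ Y mY; rewrite setTI; apply: sub_sigma_algebra => /=.
rewrite -bigcup_seq/=; exists i => /=; first by rewrite mem_index_enum.
by exists Y => //; rewrite setTI.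
Qed.

Lemma measurable_fun_coordP d (T : measurableType d) (R : realType) n
    (f : T -> 'cV[R]_n) :
  (forall i, measurable_fun setT (fun x => f x i ord0)) -> measurable_fun setT f.
Proof.
move=> mf; have : @g_sigma_preimage _ R _ n (fun i x => f x i ord0)
    `<=` measurable.
  apply: smallest_sub; first exact: sigma_algebra_measurable.
  case: n => [|n] in f mf *; first by rewrite big_ord0.
  rewrite -bigcup_mkord_ord; apply: bigcup_sub => i Ii.
  by move=> A [B mB <-]; exact: mf.
rewrite (_ : (fun i x => f x i ord0) =
  (fun i => (fun v : 'cV[R]_n => v i ord0) \o f)) //.
rewrite g_sigma_preimage_comp => sub _ A mA.
by apply: sub; exists A.
Qed.

Section lebesgue_cV.
Variable R : realType.

Definition consv n (u : R * 'cV[R]_n) : 'cV[R]_n.+1 :=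
  \col_i oapp (fun j => u.2 j ord0) u.1 (unlift ord0 i).

Definition unconsv n (v : 'cV[R]_n.+1) : R * 'cV[R]_n :=
  (v ord0 ord0, \col_j v (lift ord0 j) ord0).

Lemma consvK n : cancel (@consv n) (@unconsv n).
Proof.
case=> x v; rewrite /unconsv /consv mxE unlift_none /=; congr (_, _).
by apply/colP => j; rewrite !mxE liftK.
Qed.

Lemma measurable_consv n : measurable_fun setT (@consv n).
Proof.
apply: measurable_fun_coordP => i; rewrite /consv.
case: (unliftP ord0 i) => [j|] ->.
- under eq_fun do rewrite mxE liftK /=.
  exact: (measurableT_comp (@measurable_coord R n j)).
- under eq_fun do rewrite mxE unlift_none /=.
  exact: measurable_fst.
Qed.

Lemma measurable_unconsv n : measurable_fun setT (@unconsv n).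
Proof.
apply: measurable_fun_pair; first exact: measurable_coord.
apply: measurable_fun_coordP => i.
under eq_fun do rewrite mxE.
exact: measurable_coord.
Qed.

Section succ.
Variables (n : nat) (m : {sigma_finite_measure set 'cV[R]_n -> \bar R}).

Definition lebesgue_succ : set 'cV[R]_n.+1 -> \bar R :=
  pushforward (lebesgue_measure \x m)%E (@consv n).

Let lebesgue_succ0 : lebesgue_succ set0 = 0%E.
Proof. by rewrite /lebesgue_succ /pushforward preimage_set0 measure0. Qed.

Let lebesgue_succ_ge0 A : (0 <= lebesgue_succ A)%E.
Proof. by rewrite /lebesgue_succ /pushforward measure_ge0. Qed.

Let lebesgue_succ_sigma_additive : semi_sigma_additive lebesgue_succ.
Proof.
have mc (A : set 'cV[R]_n.+1) : measurable A -> measurable (@consv n @^-1` A).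
  by move=> mA; rewrite -[X in measurable X]setTI; exact: measurable_consv.
move=> F mF tF mUF; rewrite /lebesgue_succ /pushforward preimage_bigcup.
apply: measure_semi_sigma_additive.
- by move=> k; exact: mc.
- apply/trivIsetP => /= i j _ _ ij; rewrite -preimage_setI.
  by move/trivIsetP : tF => /(_ _ _ _ _ ij) ->//; rewrite preimage_set0.
- by rewrite -preimage_bigcup; exact: mc.
Qed.

HB.instance Definition _ := isMeasure.Build _ _ _ lebesgue_succ
  lebesgue_succ0 lebesgue_succ_ge0 lebesgue_succ_sigma_additive.

Let lebesgue_succ_sigma_finite : sigma_finite setT lebesgue_succ.
Proof.
have /sigma_finiteP[F [FT ndF Foo]] := sigma_finiteT (@lebesgue_measure R).
have /sigma_finiteP[G [GT ndG Goo]] := sigma_finiteT m.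
exists (fun k => @unconsv n @^-1` (F k `*` G k)).
  rewrite -preimage_bigcup (_ : \bigcup_k (F k `*` G k) = setT).
    by rewrite preimage_setT.
  rewrite -subTset -setXTT FT GT => -[x v] [/= [i _ Fix] [j _ Gjv]].
  exists (maxn i j) => //; split.
  - by move: x Fix; exact/subsetPset/ndF/leq_maxl.
  - by move: v Gjv; exact/subsetPset/ndG/leq_maxr.
move=> k; have [mF Fkoo] := Foo k; have [mG Gkoo] := Goo k; split.
  rewrite -[X in measurable X]setTI; apply: measurable_unconsv => //.
  exact: measurableX.
rewrite /lebesgue_succ /pushforward -comp_preimage.
rewrite (_ : _ \o _ = idfun); last by apply/funext => u; exact: consvK.
by rewrite preimage_id product_measure1E// lte_mul_pinfty// ge0_fin_numE.
Qed.

HB.instance Definition _ := Measure_isSigmaFinite.Build _ _ _ lebesgue_succ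
  lebesgue_succ_sigma_finite.

End succ.

Fixpoint lebesgue_cV (n : nat) : {sigma_finite_measure set 'cV[R]_n -> \bar R} :=
  match n with
  | 0 => \d_(0 : 'cV[R]_0)
  | k.+1 => lebesgue_succ (lebesgue_cV k)
  end.

Lemma lebesgue_cV_box n (A : 'I_n -> set R) : (forall i, measurable (A i)) ->
  lebesgue_cV n [set v | forall i, A i (v i ord0)] =
  (\prod_(i < n) lebesgue_measure (A i))%E.
Proof.
elim: n A => [|n IHn] A mA /=.
  rewrite big_ord0 diracE mem_set //=; by case.
have mB : measurable [set v : 'cV[R]_n | forall i, A (lift ord0 i) (v i ord0)].
  rewrite (_ : mkset _ = \bigcap_(i in [set: 'I_n])
      ((fun v : 'cV[R]_n => v i ord0) @^-1` A (lift ord0 i))).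
    apply: fin_bigcap_measurable; first exact: finite_finset.
    move=> i _; rewrite -[X in measurable X]setTI.
    exact: measurable_coord.
  by apply/seteqP; split => [v Av i _|v Av i]; [exact: Av|exact: (Av i)].
rewrite big_ord_recl -IHn // -product_measure1E //; last exact: mA.
rewrite /lebesgue_succ /pushforward; congr (product_measure1 _ _ _).
apply/seteqP; split => -[x v] /=.
  move=> Av; split => [|i].
    by have := Av ord0; rewrite mxE unlift_none.
  by have := Av (lift ord0 i); rewrite mxE liftK.
move=> [Ax Av] i; rewrite mxE; case: (unliftP ord0 i) => [j|] -> /=.
  exact: Av.
by [].
Qed.

End lebesgue_cV.

Section matrix_power.
Variables (R : realType) (d : nat).

Definition expmx (A : 'M[R]_d) : 'M[R]_d :=
  limn (series (fun k => k`!%:R^-1 *: A ^+ k)).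

Definition powmx (c : R) (A : 'M[R]_d) : 'M[R]_d := expmx (ln c *: A).

(* [z] is an eigenvalue, possibly non-real, of the real matrix [A] *)
Definition ceigenvalue (A : 'M[R]_d) (z : R[i]) : Prop :=
  eigenvalue (map_mx (real_complex R) A) z.

Definition smallest_re_eigenvalue (A : 'M[R]_d) (a : R) : Prop :=
  (exists2 z, ceigenvalue A z & complex.Re z = a) /\
  (forall z, ceigenvalue A z -> a <= complex.Re z).

Definition mx_homogeneous (A : 'M[R]_d) (psi : 'cV[R]_d -> R) : Prop :=
  forall (c : R) (x : 'cV[R]_d), 0 < c -> x != 0 ->
    psi (powmx c A *m x) = c * psi x.

Definition dotv (x y : 'cV[R]_d) : R := \sum_i x i ord0 * y i ord0.

End matrix_power.

Section complex_random_variables.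
Context (R : realType) (dT : measure_display) (T : measurableType dT).

Definition cmeasurable (f : T -> R[i]) : Prop :=
  measurable_fun setT (fun t => complex.Re (f t)) /\
  measurable_fun setT (fun t => complex.Im (f t)).

Variable P : probability T R.

Definition charfun (Y : T -> R) (t : R) : R[i] :=
  (\int[P]_w cos (t * Y w)) +i* (\int[P]_w sin (t * Y w)).

(* mutual independence of a finite family; taking some of the B i to be the
   whole plane gives the product rule for subfamilies *)
Definition cindependent n (X : 'I_n -> T -> R[i]) : Prop :=
  forall B : 'I_n -> set (R * R), (forall i, measurable (B i)) ->
    P [set w | forall i, B i (complex.Re (X i w), complex.Im (X i w))] =
    (\prod_(i < n) P [set w | B i (complex.Re (X i w), complex.Im (X i w))])%E.

(* The complex variable X is isotropic symmetric alpha-stable: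
   E exp(i (a Re X + b Im X)) = exp(- s |a + i b|^alpha). *)
Definition isotropic_sas (alpha s : R) (X : T -> R[i]) : Prop :=
  cmeasurable X /\
  forall a b : R,
    charfun (fun w => a * complex.Re (X w) + b * complex.Im (X w)) 1 =
    (expR (- (s * Normc.normc (a +i* b) `^ alpha)))%:C.

End complex_random_variables.

Section stable_integral.
Context (R : realType) (d : nat) (dT : measure_display) (T : measurableType dT)
  (P : probability T R) (alpha c0 : R).
Let leb : set 'cV[R]_d -> \bar R := lebesgue_cV R d.

Definition finite_volume (A : set 'cV[R]_d) : Prop :=
  measurable A /\ (leb A < +oo)%E.

Definition abs_power_integral (f : 'cV[R]_d -> R[i]) : \bar R :=
  (\int[lebesgue_cV R d]_xi ((Normc.normc (f xi)) `^ alpha)%:E)%E.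

(* W is a complex isotropic symmetric alpha-stable random measure on R^d with
   Lebesgue control measure; c0 is the normalising constant of the
   characteristic functions. *)
Record isotropic_sas_random_measure (W : set 'cV[R]_d -> T -> R[i]) : Prop := {
  rm_law : forall A, finite_volume A ->
    isotropic_sas P alpha (c0 * fine (leb A)) (W A) ;
  rm_indep : forall n (A : 'I_n -> set 'cV[R]_d),
    (forall i, finite_volume (A i)) -> trivIset setT A ->
    cindependent P (fun i => W (A i)) ;
  rm_sigma_additive : forall A : nat -> set 'cV[R]_d,
    (forall k, finite_volume (A k)) -> trivIset setT A ->
    finite_volume (\bigcup_k A k) ->
    {ae P, forall w,
      (fun n => Normc.normc (W (\bigcup_k A k) w - \sum_(k < n) W (A k) w))
        @ \oo --> (0 : R)}
}.

(* The integral of f against W as a partial operation: [dom f] says that the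
   integral of f exists, and [I f] is then a version of its value.  Additivity
   and the characteristic function make I continuous from L^alpha to
   convergence in probability, so together with the values on indicator
   functions they determine [I f] almost surely. *)
Record stable_integral (W : set 'cV[R]_d -> T -> R[i])
    (dom : ('cV[R]_d -> R[i]) -> Prop)
    (I : ('cV[R]_d -> R[i]) -> T -> R[i]) : Prop := {
  si_integrand : forall f, dom f -> cmeasurable f ;
  si_exists : forall f, cmeasurable f ->
    dom f <-> (abs_power_integral f < +oo)%E ;
  si_measurable : forall f, dom f -> cmeasurable (I f) ;
  si_indicator : forall A, finite_volume A ->
    {ae P, forall w, I (fun xi => (\1_A xi : R)%:C) w = W A w} ;
  si_linear : forall (a b : R[i]) f g, dom f -> dom g ->
    {ae P, forall w,
      I (fun xi => a * f xi + b * g xi) w = a * I f w + b * I g w} ;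
  si_charfun : forall f, dom f -> forall t : R,
    charfun P (fun w => complex.Re (I f w)) t =
    (expR (- (c0 * `|t| `^ alpha * fine (abs_power_integral f))))%:C
}.

Definition stochastically_continuous (X : 'cV[R]_d -> T -> R) : Prop :=
  forall (x0 : 'cV[R]_d) (e : R), 0 < e ->
    P [set w | e < `|X x w - X x0 w|] @[x --> x0] --> 0%E.

End stable_integral.

Section harmonizable_field.
Variables (R : realType) (d : nat) (E : 'M[R]_d) (psi : 'cV[R]_d -> R).
Variables (alpha H : R).

Definition cexpi (t : R) : R[i] := cos t +i* sin t.

Definition harmonizable_kernel (x xi : 'cV[R]_d) : R[i] :=
  (cexpi (dotv x xi) - 1) * (psi xi `^ (- H - \tr E / alpha))%:C.

Definition harmonizable_field (T : Type)
    (I : ('cV[R]_d -> R[i]) -> T -> R[i]) (x : 'cV[R]_d) (w : T) : R :=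
  complex.Re (I (harmonizable_kernel x) w).

End harmonizable_field.

(* Main.v *)
Require Import Defs.
From HB Require Import structures.
From mathcomp Require Import all_boot all_order all_algebra.
From mathcomp Require Import all_classical all_reals all_analysis.
From mathcomp Require Import measurable_realfun complex spectral.
From mathcomp Require Import ring lra.

(** Write Gamma x for the integral over xi of
|e^(i <x, xi>) - 1|^alpha psi(xi)^(- alpha H - q); this is
[mass E psi alpha H setT x].  The kernel at [x] is integrable against the random
measure exactly when Gamma x is finite.  Since
|e^(i <x, xi>) - e^(i <y, xi>)| = |e^(i <x - y, xi>) - 1|, the increment
X x - X y is almost surely the real part of a stochastic integral with
characteristic function exp(- c0 |t|^alpha Gamma(x - y)).  Characteristic
functions control tails in both directions ([concentration_charfun],
[charfun_concentration]), so stochastic continuity says that Gamma is small near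
the origin.  It remains to see for which H the function Gamma is finite
everywhere and small near 0.

Let M = exp E.  For c = e the homogeneity of psi reads
psi(M^T xi) = e psi(xi).  As |det M| = e^q ([det_expmx]), the substitution
xi -> M^T xi, a linear change of variables ([ge0_integral_mulmx]), gives
Gamma(M x) = e^(alpha H) Gamma x; the same substitution compares the integrals
over a set and over its images under powers of M^T ([mass_inner],
[mass_outer]).

If 0 < H < a1, pick b with H < b < a1; then M^-k = O(e^(- b k))
([expmx_inv_decay]).  The powers of M^T move any nonzero vector into the compact
shell of those xi with |xi| <= 1 <= |M^T xi|, where psi is bounded and bounded
away from 0.  Images of the shell close to the origin contribute
O(|x|^alpha e^(alpha (H - b) k)) to Gamma x, because |e^(i u) - 1| <= |u|;
remote images contribute O(e^(- alpha H k)), because |e^(i u) - 1| <= 2.  Both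
series are geometric, so Gamma x <= A1 |x|^alpha + A2 ([mass_setT_bound]), and
Gamma x = e^(- alpha H k) Gamma(M^k x) then makes Gamma small near 0
([mass_setT_small]).

If H <= 0, then Gamma(M^-k x) = e^(- alpha H k) Gamma x >= Gamma x > 0 although
M^-k x tends to 0, which contradicts continuity at 0
([stochastically_continuous_exponent_gt0]).

If H >= a1, take a complex eigenvector v = x + i y of M whose eigenvalue mu has
modulus e^a1.  On a small cube B the pairing <v, xi> stays away from 0 while psi
oscillates by less than a factor e; hence the preimages of B under the powers of
M^T are disjoint.  From <M^-k v, xi> = mu^-k <v, xi> the k-th preimage
contributes at least a constant times e^(alpha (H - a1) k) >= 1 to
Gamma x + Gamma y, so this sum is infinite ([finite_mass_lt]).

The facts about exp E come from one device: exp E is the limit of the polynomials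
[exp_trunc] evaluated at E, and a triangularisation of E over the complex numbers
displays the diagonal of every polynomial in E ([exp_similar_trig]). *)

Import Order.TTheory GRing.Theory Num.Theory.
Import numFieldNormedType.Exports.
Local Open Scope classical_set_scope.
Local Open Scope ring_scope.

Set Implicit Arguments.
Unset Strict Implicit.
Unset Printing Implicit Defensive.

(** * Linear changes of variables for Lebesgue measure *)

Section affine_line.
Context {R : realType}.
Local Notation mu := (@lebesgue_measure R).

Lemma lebesgue_measure_shift (b : R) (A : set R) : measurable A ->
  pushforward mu (+%R b : _ -> measurableTypeR R) A = mu A.
Proof.
move=> mA; apply/esym/lebesgue_measure_unique => //=.
  exact: measurable_funD.
move=> mf _ [[x y]] _ <-.
rewrite /pushforward /=.
have -> : +%R b @^-1` `]x, y]%classic = `]x - b, y - b]%classic.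
  by apply/seteqP; split => z /=; rewrite !in_itv/= ltrBlDl lerBrDl.
rewrite !lebesgue_measure_itv/= !lte_fin ltrD2r -!EFinB.
by have -> : y - b - (x - b) = y - x by lra.
Qed.

Lemma ge0_integral_shift (b : R) (f : R -> \bar R) :
  measurable_fun setT f -> (forall x, (0 <= f x)%E) ->
  (\int[mu]_x f (b + x)%R = \int[mu]_x f x)%E.
Proof.
move=> mf f0.
have mg : measurable_fun setT (+%R b : measurableTypeR R -> measurableTypeR R).
  exact: measurable_funD.
have := ge0_integral_pushforward mg mu measurableT mf (fun x _ => f0 x).
rewrite preimage_setT /= => <-.
by apply: eq_measure_integral => A mA _; exact: lebesgue_measure_shift.
Qed.

Lemma measurable_scale (a : R) :
  measurable_fun setT ( *%R a : measurableTypeR R -> measurableTypeR R).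
Proof. exact: measurable_funM. Qed.

(** Lebesgue measure is determined by its values on intervals, and an interval
shrinks by the factor [a] under the preimage by x -> a x. *)
Lemma lebesgue_measure_scale (a : R) (a0 : 0 < a) (A : set R) : measurable A ->
  pushforward (mscale (PosNum a0)%:num%:nng mu)
    ( *%R a : _ -> measurableTypeR R) A = mu A.
Proof.
move=> mA; apply/esym/lebesgue_measure_unique => //= _ [[x y]] _ <-.
rewrite /pushforward /mscale /=.
have -> : *%R a @^-1` `]x, y]%classic = `]a^-1 * x, a^-1 * y]%classic.
  apply/seteqP; split => z /=; rewrite !in_itv/=.
    by rewrite ler_pdivlMl// ltr_pdivrMl.
  by rewrite ler_pdivlMl// ltr_pdivrMl.
rewrite !lebesgue_measure_itv/= !lte_fin ltr_pM2l ?invr_gt0//.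
case: ifPn => _; last by rewrite mule0.
by rewrite -!EFinB -EFinM -mulrBr mulrA divff ?gt_eqF// mul1r.
Qed.

(** The case [a < 0] reduces to [a > 0] by the reflection invariance of Lebesgue
measure. *)
Lemma ge0_integral_scale (a : R) (f : R -> \bar R) : a != 0 ->
  measurable_fun setT f -> (forall x, (0 <= f x)%E) ->
  (`|a|%:E * \int[mu]_x f (a * x)%R = \int[mu]_x f x)%E.
Proof.
wlog a0 : a f / 0 < a => [hwlog|].
  rewrite neq_lt => /orP[a0|a0] mf f0; last by apply: hwlog => //; rewrite gt_eqF.
  have Na0 : 0 < - a by rewrite oppr_gt0.
  have mN : measurable_fun setT (-%R : measurableTypeR R -> measurableTypeR R).
    exact: oppr_measurable.
  have mfN : measurable_fun setT (fun x : R => f (- x)%R).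
    exact: (measurableT_comp mf mN).
  have := hwlog (- a) (fun x => f (- x)%R) Na0 (negbT (gt_eqF Na0)) mfN
    (fun x => f0 (- x)%R).
  rewrite normrN.
  under eq_integral do rewrite mulNr opprK.
  move=> ->.
  have := ge0_integral_pushforward mN mu measurableT mf (fun x _ => f0 x).
  rewrite preimage_setT /= => <-.
  by apply: eq_measure_integral => A mA _; exact: lebesgue_measureN.
move=> _ mf f0.
have mfa : measurable_fun setT (fun x => f (a * x)%R).
  exact: (measurableT_comp mf (measurable_scale a)).
rewrite gtr0_norm // (_ : a%:E = ((PosNum a0)%:num%:nng)%:num%:E)//.
rewrite -ge0_integral_mscale//.
have := ge0_integral_pushforward (measurable_scale a)
  (mscale (PosNum a0)%:num%:nng mu) measurableT mf (fun x _ => f0 x).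
rewrite preimage_setT /= => <-.
by apply: eq_measure_integral => A mA _; exact: lebesgue_measure_scale.
Qed.

End affine_line.

Section head_tail_decomposition.
Variable R : realType.
Local Notation mu := (@lebesgue_measure R).
Local Notation leb n := (lebesgue_cV R n).

Lemma measurable_mulmx m n (M : 'M[R]_(m, n)) :
  measurable_fun setT (fun x : 'cV[R]_n => M *m x).
Proof.
apply: measurable_fun_coordP => i.
under eq_fun do rewrite mxE.
apply: measurable_sum => j.
by apply: measurable_funM => //; exact: measurable_coord.
Qed.

Lemma measurable_addv n (a : 'cV[R]_n) :
  measurable_fun setT (fun x : 'cV[R]_n => a + x).
Proof.
apply: measurable_fun_coordP => i.
under eq_fun do rewrite mxE.
by apply: measurable_funD => //; exact: measurable_coord.
Qed.

(** Prepending a coordinate is block concatenation; this lets the product formulas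
for block matrices act on the recursive construction of [lebesgue_cV]. *)
Lemma consvE n (x : R) (v : 'cV[R]_n) : consv (x, v) = col_mx x%:M v :> 'cV[R]_(1 + n).
Proof.
apply/colP => i; rewrite !mxE; case: splitP => j ij.
  rewrite (_ : i = ord0); last by apply/val_inj; rewrite /= ij ord1.
  by rewrite unlift_none/= ord1 !mxE.
by rewrite (_ : i = lift ord0 j) ?liftK//; apply/val_inj; rewrite /= ij.
Qed.

Variables (n : nat) (f : 'cV[R]_n.+1 -> \bar R).
Hypotheses (mf : measurable_fun setT f) (f0 : forall x, (0 <= f x)%E).

Lemma integral_cVS_prod :
  (\int[leb n.+1]_v f v = \int[(mu \x leb n)%E]_u f (consv u))%E.
Proof.
have mc : measurable_fun setT
    (@consv R n : measurableTypeR R * 'cV[R]_n -> 'cV[R]_n.+1).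
  exact: measurable_consv.
have := ge0_integral_pushforward mc (mu \x leb n)%E
  measurableT mf (fun x _ => f0 x).
rewrite preimage_setT /= => <-.
exact: eq_measure_integral.
Qed.

Lemma measurable_consv_comp :
  measurable_fun [set: measurableTypeR R * 'cV[R]_n] (fun u => f (consv u)).
Proof. exact: (measurableT_comp mf (@measurable_consv R n)). Qed.

(** Together with [integral_cVS_head], Tonelli in the two orders: shears in the
head coordinate integrate it first, the other substitutions integrate it last. *)
Lemma integral_cVS_tail :
  (\int[leb n.+1]_v f v = \int[leb n]_v \int[mu]_x f (consv (x, v)))%E.
Proof.
by rewrite integral_cVS_prod (fubini_tonelli2 _ measurable_consv_comp).
Qed.

Lemma integral_cVS_head :
  (\int[leb n.+1]_v f v = \int[mu]_x \int[leb n]_v f (consv (x, v)))%E.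
Proof.
by rewrite integral_cVS_prod (fubini_tonelli1 _ measurable_consv_comp).
Qed.

Lemma measurable_integral_consv :
  measurable_fun [set: measurableTypeR R]
    (fun x => \int[leb n]_v f (consv (x, v)))%E.
Proof. exact: (measurable_fun_fubini_tonelli_F _ measurable_consv_comp). Qed.

Lemma measurable_consv_fst (v : 'cV[R]_n) :
  measurable_fun setT (fun x => f (consv (x, v))).
Proof.
apply: (measurableT_comp mf); apply: (measurableT_comp (@measurable_consv R n)).
exact: measurable_pair2.
Qed.

Lemma measurable_consv_snd (x : R) :
  measurable_fun setT (fun v => f (consv (x, v))).
Proof.
apply: (measurableT_comp mf); apply: (measurableT_comp (@measurable_consv R n)).
exact: measurable_pair1.
Qed.

End head_tail_decomposition.

Section linear_change_of_variables.
Variable R : realType.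
Local Notation leb n := (lebesgue_cV R n).

Lemma ge0_integral_cV_shift n (a : 'cV[R]_n) (f : 'cV[R]_n -> \bar R) :
  measurable_fun setT f -> (forall x, (0 <= f x)%E) ->
  (\int[leb n]_v f (a + v)%R = \int[leb n]_v f v)%E.
Proof.
elim: n a f => [|n IHn] a f mf f0.
  by apply: eq_integral => v _; congr f; apply/colP => -[].
have mfa := measurableT_comp mf (measurable_addv a).
rewrite (integral_cVS_head mfa (fun=> f0 _)) (integral_cVS_head mf f0).
rewrite -[RHS](ge0_integral_shift (a ord0 ord0)) /=; last 2 first.
- exact: (measurable_integral_consv mf f0).
- by move=> x; exact: integral_ge0.
apply: eq_integral => x _.
rewrite -[RHS](IHn (\col_j a (lift ord0 j) ord0)) //; last exact: measurable_consv_snd.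
apply: eq_integral => v _; congr f; apply/colP => i; rewrite !mxE.
case: (unliftP ord0 i) => [j|] -> /=; rewrite ?liftK ?unlift_none//=.
by rewrite !mxE.
Qed.

(** Stated for all nonnegative integrands at once, which makes the property stable
under products of matrices. *)
Definition scales_lebesgue n (M : 'M[R]_n) :=
  forall f, measurable_fun setT f -> (forall x, (0 <= f x)%E) ->
  (`|\det M|%:E * \int[leb n]_v f (M *m v)%R = \int[leb n]_v f v)%E.

Lemma scales_lebesgueM n (M N : 'M[R]_n) :
  scales_lebesgue M -> scales_lebesgue N -> scales_lebesgue (M *m N).
Proof.
move=> MP NP f mf f0; rewrite det_mulmx normrM EFinM -muleA.
under eq_integral do rewrite -mulmxA.
rewrite (NP (fun v => f (M *m v)))//; first exact: MP.
exact: (measurableT_comp mf (measurable_mulmx _)).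
Qed.

(** For a fixed tail, the shear translates the head coordinate. *)
Lemma scales_upper_shear n (w : 'rV[R]_n) :
  scales_lebesgue (block_mx 1%:M w 0 1%:M : 'M[R]_(1 + n)).
Proof.
move=> f mf f0; rewrite det_ublock !det1 mulr1 normr1 mul1e.
have mfM := measurableT_comp mf (measurable_mulmx (block_mx 1%:M w 0 1%:M : 'M[R]_(1 + n))).
rewrite (integral_cVS_tail mfM (fun=> f0 _)) (integral_cVS_tail mf f0).
apply: eq_integral => v _.
rewrite -[RHS](ge0_integral_shift ((w *m v) ord0 ord0))//.
  apply: eq_integral => x _; congr f; rewrite !consvE mul_block_col.
  rewrite !mul1mx mul0mx add0r; congr col_mx.
  by rewrite [X in _ + X = _]mx11_scalar -raddfD/= addrC.
exact: measurable_consv_fst.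
Qed.

(** For a fixed head, the shear translates the tail. *)
Lemma scales_lower_shear n (u : 'cV[R]_n) :
  scales_lebesgue (block_mx 1%:M 0 u 1%:M : 'M[R]_(1 + n)).
Proof.
move=> f mf f0; rewrite det_lblock !det1 mulr1 normr1 mul1e.
have mfM := measurableT_comp mf (measurable_mulmx (block_mx 1%:M 0 u 1%:M : 'M[R]_(1 + n))).
rewrite (integral_cVS_head mfM (fun=> f0 _)) (integral_cVS_head mf f0).
apply: eq_integral => x _.
rewrite -[RHS](ge0_integral_cV_shift (x *: u))//.
  apply: eq_integral => v _; congr f; rewrite !consvE mul_block_col.
  by rewrite !mul1mx mul0mx addr0 mul_mx_scalar.
exact: measurable_consv_snd.
Qed.

Lemma scales_diag_block n (a : R) (N : 'M[R]_n) : a != 0 -> scales_lebesgue N ->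
  scales_lebesgue (block_mx a%:M 0 0 N : 'M[R]_(1 + n)).
Proof.
move=> a0 NP f mf f0; rewrite det_lblock det_scalar1 normrM EFinM -muleA.
have mfM := measurableT_comp mf (measurable_mulmx (block_mx a%:M 0 0 N : 'M[R]_(1 + n))).
rewrite (integral_cVS_head mfM (fun=> f0 _)) (integral_cVS_head mf f0).
rewrite -ge0_integralZl//; first last.
- by move=> x _; apply: integral_ge0 => v _; exact: f0.
- exact: (measurable_integral_consv mfM (fun=> f0 _)).
rewrite -[RHS](ge0_integral_scale a0)//; last 2 first.
- exact: (measurable_integral_consv mf f0).
- by move=> x; exact: integral_ge0.
congr (_ * _)%E; apply: eq_integral => x _.
rewrite -[RHS]NP//; last exact: measurable_consv_snd.
congr (_ * _)%E; apply: eq_integral => v _; congr f; rewrite !consvE mul_block_col.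
by rewrite !mul0mx addr0 add0r -scalar_mxM.
Qed.

(** A nonzero pivot gives the block LDU factorisation: lower shear, block diagonal
with the Schur complement, upper shear. *)
Lemma scales_pivot n (M : 'M[R]_(1 + n)) :
  (forall N : 'M[R]_n, \det N != 0 -> scales_lebesgue N) ->
  M ord0 ord0 != 0 -> \det M != 0 -> scales_lebesgue M.
Proof.
move=> IHn a0 M0.
set a := M ord0 ord0 in a0.
have aE : ulsubmx M = a%:M.
  by rewrite [LHS]mx11_scalar !mxE; congr (M _ _)%:M; exact/val_inj.
set N := drsubmx M - dlsubmx M *m (a^-1 *: ursubmx M).
have ME : M = block_mx 1%:M 0 (a^-1 *: dlsubmx M) 1%:M *m
  (block_mx a%:M 0 0 N *m block_mx 1%:M (a^-1 *: ursubmx M) 0 1%:M).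
  rewrite !mulmx_block !(mulmx0, mul0mx, mulmx1, mul1mx, addr0, add0r).
  rewrite -[LHS]submxK aE; congr block_mx.
  - by rewrite mul_scalar_mx scalerA divff// scale1r.
  - by rewrite mul_mx_scalar scalerA divff// scale1r.
  - rewrite mul_scalar_mx scalerA divff// scale1r /N -scalemxAl -scalemxAr.
    by rewrite addrC subrK.
rewrite ME; apply: scales_lebesgueM; first exact: scales_lower_shear.
apply: scales_lebesgueM; last exact: scales_upper_shear.
apply: scales_diag_block => //; apply: IHn.
apply: contraNneq M0 => N0.
by rewrite ME !det_mulmx !det_lblock N0 !(mulr0, mul0r).
Qed.

(** Induction on the dimension by Gaussian elimination. When the corner entry
vanishes, some entry below it does not, and an upper shear (adding that row to the
first one) brings it into the corner. *)
Lemma ge0_integral_mulmx n (M : 'M[R]_n) : \det M != 0 -> scales_lebesgue M.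
Proof.
elim: n M => [|n IHn] M M0.
  move=> f mf f0; rewrite det_mx00 normr1 mul1e.
  by apply: eq_integral => v _; congr f; apply/colP => -[].
have [a0|] := eqVneq (M ord0 ord0) 0; last by move=> ?; exact: (@scales_pivot n).
have [i Mi] : exists i : 'I_n, M (lift ord0 i) ord0 != 0.
  apply/existsP; apply: contraNT M0; rewrite negb_exists => /forallP M0.
  rewrite (expand_det_col _ ord0) big1// => i _.
  case: (unliftP ord0 i) => [j|] ->; last by rewrite a0 mul0r.
  by have := M0 j; rewrite negbK => /eqP ->; rewrite mul0r.
pose w : 'rV[R]_n := delta_mx ord0 i.
pose U (w : 'rV[R]_n) : 'M[R]_(1 + n) := block_mx 1%:M w 0 1%:M.
have ME : M = U (- w) *m (U w *m M).
  rewrite mulmxA mulmx_block !(mulmx0, mul0mx, mulmx1, mul1mx, addr0, add0r) subrr.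
  by rewrite -scalar_mx_block mul1mx.
rewrite ME; apply: scales_lebesgueM; first exact: scales_upper_shear.
apply: (@scales_pivot n) => //; last first.
  by rewrite det_mulmx det_ublock !det1 !mul1r.
have e0 : (ord0 : 'I_n.+1) = lshift n (ord0 : 'I_1) by exact/val_inj.
have er j : lift ord0 j = rshift 1 j :> 'I_n.+1 by exact/val_inj.
have U0 : U w ord0 ord0 = 1 by rewrite /U e0 block_mxEul mxE eqxx.
have Ur j : U w ord0 (lift ord0 j) = (j == i)%:R.
  by rewrite /U er e0 block_mxEur mxE eqxx.
rewrite mxE big_ord_recl U0 a0 mulr0 add0r (bigD1 i)//= big1 ?addr0 => [|j ji].
  by rewrite Ur eqxx mul1r.
by rewrite Ur (negbTE ji) mul0r.
Qed.

End linear_change_of_variables.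

(** * The matrix exponential as a limit of polynomials *)

Section truncated_exponential.

Definition exp_trunc (F : fieldType) N : {poly F} :=
  \poly_(k < N) (k`!%:R)^-1.

Lemma horner_exp_trunc (F : fieldType) N (x : F) :
  (exp_trunc F N).[x] = \sum_(k < N) x ^+ k / k`!%:R.
Proof. by rewrite horner_poly; apply: eq_bigr => k _; rewrite mulrC. Qed.

(** The defect of multiplicativity of the truncated exponential has a closed form
with nonnegative coefficients, so over the complex numbers it is dominated by the
same defect at the moduli ([exp_truncM_normc]), which tends to 0. *)
Lemma exp_truncM (F : numFieldType) N (x y : F) :
  (exp_trunc F N).[x] * (exp_trunc F N).[y] - (exp_trunc F N).[x + y] =
  \sum_(i < N) \sum_(j < N | (N <= i + j)%N)
    (x ^+ i / i`!%:R) * (y ^+ j / j`!%:R).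
Proof.
have fact0 k : (k`!%:R : F) != 0 by rewrite pnatr_eq0 -lt0n fact_gt0.
pose G i j := (x ^+ i / i`!%:R) * (y ^+ j / j`!%:R) : F.
have -> : (exp_trunc F N).[x] * (exp_trunc F N).[y] =
    \sum_(i < N) \sum_(j < N) G i j.
  by rewrite !horner_exp_trunc big_distrlr.
suff -> : (exp_trunc F N).[x + y] =
    \sum_(i < N) \sum_(j < N | (i + j < N)%N) G i j.
  apply/eqP; rewrite subr_eq -big_split/=; apply/eqP; apply: eq_bigr => i _.
  rewrite (bigID (fun j : 'I_N => (N <= i + j)%N))/=; congr (_ + _).
  by apply: eq_bigl => j; rewrite -ltnNge.
rewrite horner_exp_trunc.
transitivity (\sum_(k < N) \sum_(i < N | (i <= k)%N) G i (k - i)%N).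
  apply: eq_bigr => k _; rewrite addrC exprDn mulr_suml.
  rewrite (big_ord_widen_cond N predT (fun i => y ^+ (k - i) * x ^+ i *+ 'C(k, i) / k`!%:R))//=.
  apply: eq_big => [i|i ik]; first by rewrite ltnS.
  rewrite ltnS in ik.
  rewrite /G -(bin_fact ik) -[_ *+ 'C(_, _)]mulr_natl !natrM.
  have := fact0 i; have := fact0 (k - i)%N.
  have : ('C(k, i)%:R : F) != 0 by rewrite pnatr_eq0 -lt0n bin_gt0.
  by move=> h1 h2 h3; field; rewrite h1 h2 h3.
rewrite (exchange_big_dep xpredT)//=; apply: eq_bigr => i _.
rewrite -(big_geq_mkord i N xpredT (fun k => G i (k - i)%N)) -{1}[i : nat]add0n.
rewrite big_addn big_mkord (big_ord_widen _ (fun k => G i (k + i - i)%N) (leq_subr i N)).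
by apply: eq_big => [j|j _]; rewrite ?ltn_subRL// addnK.
Qed.

Lemma normc_real (R : rcfType) (x : R) : Normc.normc x%:C%C = `|x|.
Proof. by rewrite /= expr0n/= addr0 sqrtr_sqr. Qed.

Lemma normc_ge0 (R : rcfType) (z : R[i]) : 0 <= Normc.normc z.
Proof. by case: z => a b /=; exact: sqrtr_ge0. Qed.

Lemma normr_normc (R : rcfType) (z : R[i]) : `|z| = (Normc.normc z)%:C%C.
Proof. by []. Qed.

End truncated_exponential.

Section exp_trunc_limit.
Variable R : realType.
Local Notation toC := (real_complex R).
Local Notation normc := Normc.normc.

Lemma cvg_exp_trunc (x : R) : (exp_trunc R N).[x] @[N --> \oo] --> expR x.
Proof.
rewrite /expR; apply: cvg_trans (is_cvg_series_exp_coeff x).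
apply: near_eq_cvg; near=> N.
by rewrite horner_exp_trunc /series/= big_mkord.
Unshelve. all: end_near. Qed.

Lemma horner_exp_trunc_real N (x : R) :
  (exp_trunc R[i] N).[toC x] = toC (exp_trunc R N).[x].
Proof.
rewrite !horner_exp_trunc rmorph_sum; apply: eq_bigr => k _.
by rewrite fmorph_div rmorphXn rmorph_nat.
Qed.

Lemma horner_exp_trunc_conj N (z : R[i]) :
  (exp_trunc R[i] N).[conjc z] = conjc (exp_trunc R[i] N).[z].
Proof.
rewrite !horner_exp_trunc rmorph_sum; apply: eq_bigr => k _.
by rewrite fmorph_div rmorphXn rmorph_nat.
Qed.

Lemma exp_truncM_normc N (x y : R[i]) :
  normc ((exp_trunc R[i] N).[x] * (exp_trunc R[i] N).[y]
         - (exp_trunc R[i] N).[x + y]) <=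
  (exp_trunc R N).[normc x] * (exp_trunc R N).[normc y]
  - (exp_trunc R N).[normc x + normc y].
Proof.
rewrite -lecR -normr_normc !exp_truncM rmorph_sum.
apply: le_trans (ler_norm_sum _ _ _) _; apply: ler_sum => i _.
rewrite rmorph_sum; apply: le_trans (ler_norm_sum _ _ _) _.
apply: ler_sum => j _.
rewrite !rmorphM/= !rmorphXn/= !fmorphV !rmorph_nat -!normr_normc.
by rewrite !normrM !normrX !normfV !normr_nat.
Qed.

(** This avoids the complex exponential function: the squared modulus of the
truncation at z is its value at z times its value at the conjugate, which differs
from the truncation at the real number z + z^* by a defect tending to 0. *)
Lemma cvg_normc_exp_trunc (z : R[i]) :
  normc (exp_trunc R[i] N).[z] @[N --> \oo] --> expR (complex.Re z).
Proof.
pose u N := (exp_trunc R[i] N).[z].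
have normcE w : normc w = Num.sqrt (normc w ^+ 2).
  by rewrite sqrtr_sqr ger0_norm// normc_ge0.
suff : (normc (u N) ^+ 2 : R) @[N --> \oo] --> expR (complex.Re z *+ 2).
  move=> /(continuous_cvg _ (@sqrt_continuous _ _)).
  rewrite -mulr_natl expRM_natl sqrtr_sqr ger0_norm ?expR_ge0// => h.
  by under eq_fun do rewrite normcE.
pose e N : R := (exp_trunc R N).[normc z] * (exp_trunc R N).[normc z]
  - (exp_trunc R N).[normc z + normc z].
have e0 : e N @[N --> \oo] --> (0 : R).
  rewrite (_ : 0 = expR (normc z) * expR (normc z) - expR (normc z + normc z)).
    by apply: cvgB; [apply: cvgM|]; exact: cvg_exp_trunc.
  by rewrite expRD subrr.
have le_e N : `|normc (u N) ^+ 2 - (exp_trunc R N).[complex.Re z *+ 2]| <= e N.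
  have := exp_truncM_normc N z (conjc z).
  have zz : z + conjc z = toC (complex.Re z *+ 2).
    by case: z {u normcE e e0} => a b; rewrite /= mulr2n; simpc.
  rewrite zz horner_exp_trunc_real horner_exp_trunc_conj -sqr_normc.
  rewrite normr_normc -rmorphXn -rmorphB normc_real.
  by have -> : normc (conjc z) = normc z by have := normcJ z; rewrite !normr_normc => -[].
apply/cvgrPdist_lt => eps eps0; near=> N.
have -> : expR (complex.Re z *+ 2) - normc (u N) ^+ 2 =
  expR (complex.Re z *+ 2) - (exp_trunc R N).[complex.Re z *+ 2] +
  ((exp_trunc R N).[complex.Re z *+ 2] - normc (u N) ^+ 2) by ring.
apply: (le_lt_trans (ler_normD _ _)); rewrite [eps]splitr; apply: ltrD.
  near: N; apply: (@cvgr_dist_lt _ _ _ _ _ (fun N => (exp_trunc R N).[_])).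
    exact: cvg_exp_trunc.
  by rewrite divr_gt0.
rewrite distrC; apply: (le_lt_trans (le_e N)).
near: N; have := @cvgr_lt _ _ _ _ _ _ e0; apply; by rewrite divr_gt0.
Unshelve. all: end_near. Qed.

End exp_trunc_limit.

Section matrix_exponential.
Variables (R : realType) (n : nat).
Implicit Types A : 'M[R]_n.+1.
Local Notation toC := (real_complex R).
Local Notation normc := Normc.normc.

Lemma ler_mx_entry p q (A : 'M[R]_(p, q)) i j : `|A i j| <= `|A|.
Proof.
rewrite [leRHS]/Num.norm/= mx_normrE.
exact: (@le_bigmax _ _ _ 0 (fun ij : 'I_p * 'I_q => `|A ij.1 ij.2|) (i, j)).
Qed.

Lemma ler_mx_norm p q (A : 'M[R]_(p, q)) c : 0 <= c ->
  (forall i j, `|A i j| <= c) -> `|A| <= c.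
Proof.
move=> c0 Ac; rewrite [leLHS]/Num.norm/= mx_normrE.
by apply: bigmax_le => // -[i j] _; exact: Ac.
Qed.

Lemma ler_normM_mulmx p q r (A : 'M[R]_(p, q)) (B : 'M[R]_(q, r)) :
  `|A *m B| <= q%:R * `|A| * `|B|.
Proof.
apply: ler_mx_norm => [|i j]; first by rewrite !mulr_ge0.
rewrite mxE; apply: (le_trans (ler_norm_sum _ _ _)).
apply: (@le_trans _ _ (\sum_(k < q) (`|A| * `|B|))).
  by apply: ler_sum => k _; rewrite normrM ler_pM// ler_mx_entry.
by rewrite sumr_const card_ord -mulrA mulr_natl.
Qed.

Lemma ler_norm_expmx A k : `|A ^+ k| <= (n.+1%:R * `|A|) ^+ k.
Proof.
elim: k => [|k IHk].
  rewrite !expr0; apply: ler_mx_norm => // i j.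
  by rewrite mxE; case: eqP => _; rewrite ?normr1 ?normr0.
rewrite exprS; apply: (le_trans (ler_normM_mulmx _ _)).
by rewrite exprS ler_wpM2l// mulr_ge0.
Qed.

(* Square matrices form a complete normed space, so absolutely convergent series
   converge. *)
#[local] HB.instance Definition _ :=
  Uniform_isComplete.Build 'M[R]_n.+1 cauchy_cvg.

Lemma cvg_series_expmx A :
  (series (fun k => k`!%:R^-1 *: A ^+ k) : nat -> 'M[R]_n.+1) @ \oo --> expmx A.
Proof.
suff : cvgn (series (fun k => k`!%:R^-1 *: A ^+ k) : nat -> 'M[R]_n.+1) by [].
apply: normed_cvg.
apply: (@series_le_cvg _ _ (exp_coeff (n.+1%:R * `|A|))).
- by move=> k /=.
- by move=> k; apply: exp_coeff_ge0; rewrite mulr_ge0.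
- move=> k /=; rewrite normrZ normfV normr_nat mulrC ler_wpM2r ?invr_ge0//.
  exact: ler_norm_expmx.
- exact: is_cvg_series_exp_coeff.
Qed.

Lemma series_expmxE A N :
  series (fun k => k`!%:R^-1 *: A ^+ k) N = horner_mx A (exp_trunc R N).
Proof.
rewrite /series/= big_mkord /exp_trunc poly_def rmorph_sum/=.
by apply: eq_bigr => k _; rewrite linearZ/= rmorphXn/= horner_mx_X.
Qed.

Lemma cvg_horner_expmx A : horner_mx A (exp_trunc R N) @[N --> \oo] --> expmx A.
Proof.
have := @cvg_series_expmx A.
by rewrite (_ : series _ = fun N => horner_mx A (exp_trunc R N))//; apply/funext => N; exact: series_expmxE.
Qed.

Lemma horner_mx_trmx A (p : {poly R}) : horner_mx A^T p = (horner_mx A p)^T.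
Proof.
elim/poly_ind: p => [|p c IHp]; first by rewrite !rmorph0 trmx0.
rewrite !rmorphD !rmorphM/= !horner_mx_X !horner_mx_C raddfD/= tr_scalar_mx IHp.
congr (_ + _); rewrite -!mulmxE -[in RHS]comm_mx_horner.
  by rewrite trmx_mul.
exact: comm_mx_refl.
Qed.

Lemma cvg_trmx T (F : set_system T) {FF : Filter F} p q
    (u : T -> 'M[R]_(p, q)) (l : 'M[R]_(p, q)) :
  u @ F --> l -> ((u N)^T : 'M[R]_(q, p)) @[N --> F] --> (l^T : 'M[R]_(q, p)).
Proof.
move=> ul; apply/cvgrPdist_le => eps eps0; near=> N.
apply: (@le_trans _ _ `|l - u N|).
  apply: ler_mx_norm => // i j.
  by have := ler_mx_entry (l - u N) j i; rewrite !mxE.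
by near: N; apply: cvgr_dist_le.
Unshelve. all: end_near. Qed.

Lemma expmx_trmx A : expmx A^T = (expmx A)^T.
Proof.
have h := @cvg_horner_expmx A^T.
apply: (cvg_unique _ h) => //.
have -> : (fun N => horner_mx A^T (exp_trunc R N)) =
    fun N => (horner_mx A (exp_trunc R N))^T.
  by apply/funext => N; exact: horner_mx_trmx.
exact: cvg_trmx (@cvg_horner_expmx A).
Qed.

(** [eigenvalue (mxC A)] is [ceigenvalue A] up to conversion. *)
Definition mxC p q (A : 'M[R]_(p, q)) : 'M[R[i]]_(p, q) := map_mx toC A.

Lemma mxC_trmx p q (A : 'M[R]_(p, q)) : mxC A^T = (mxC A)^T.
Proof. by rewrite /mxC map_trmx. Qed.

Lemma mxCM p q r (A : 'M[R]_(p, q)) (B : 'M[R]_(q, r)) :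
  mxC (A *m B) = mxC A *m mxC B.
Proof. exact: map_mxM. Qed.

Lemma mxC1 p : mxC (1%:M : 'M[R]_p) = 1%:M.
Proof. exact: map_mx1. Qed.

Lemma ler_normc_sum I (r : seq I) (P : pred I) (F : I -> R[i]) :
  normc (\sum_(i <- r | P i) F i) <= \sum_(i <- r | P i) normc (F i).
Proof.
rewrite -lecR -normr_normc rmorph_sum/=; apply: le_trans (ler_norm_sum _ _ _) _.
by apply: ler_sum => i _; rewrite normr_normc.
Qed.

Lemma normc_mulmx2 p q (P : 'M[R[i]]_(p, n.+1)) (X : 'M[R[i]]_n.+1)
    (Q : 'M[R[i]]_(n.+1, q)) c i j : (forall k l, normc (X k l) <= c) ->
  normc ((P *m X *m Q) i j) <=
  (\sum_l \sum_k normc (P i k) * normc (Q l j)) * c.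
Proof.
move=> Xc; rewrite mxE; apply: (le_trans (ler_normc_sum _ _ _)).
rewrite mulr_suml; apply: ler_sum => l _.
rewrite Normc.normcM mxE.
apply: le_trans (ler_wpM2r (normc_ge0 _) (ler_normc_sum _ _ _)) _.
rewrite !mulr_suml; apply: ler_sum => k _.
rewrite Normc.normcM mulrAC; apply: ler_wpM2l => //.
by rewrite mulr_ge0 ?normc_ge0.
Qed.

Lemma cvg_mulmxC p q (P : 'M[R[i]]_(p, n.+1)) (Q : 'M[R[i]]_(n.+1, q))
    (u : nat -> 'M[R]_n.+1) (l : 'M[R]_n.+1) i j : u @ \oo --> l ->
  normc ((P *m mxC (u N) *m Q) i j - (P *m mxC l *m Q) i j) @[N --> \oo] --> (0 : R).
Proof.
move=> ul.
set K := \sum_l \sum_k normc (P i k) * normc (Q l j).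
have Kul : K * `|u N - l| @[N --> \oo] --> (0 : R).
  rewrite -[0](mulr0 K); apply: cvgM; first exact: cvg_cst.
  have := cvg_norm (cvgB ul (@cvg_cst _ l nat \oo _)).
  by rewrite subrr normr0; exact.
have c0 : (fun=> 0 : R) @ \oo --> (0 : R) by exact: cvg_cst.
apply: (squeeze_cvgr _ c0 Kul); near=> N.
rewrite normc_ge0/= (_ : _ - _ = (P *m mxC (u N - l) *m Q) i j).
  by apply: normc_mulmx2 => k m; rewrite mxE normc_real ler_mx_entry.
by rewrite /mxC raddfB/= mulmxBr mulmxBl !mxE.
Unshelve. all: end_near. Qed.

End matrix_exponential.

(** * Spectrum, determinant and powers of the matrix exponential *)

Section triangular_matrices.
Variable (F : fieldType) (n : nat).
Implicit Types A B P T : 'M[F]_n.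

Lemma mulmx_trig A B : is_trig_mx A -> is_trig_mx B -> is_trig_mx (A *m B).
Proof.
move=> /is_trig_mxP Atrig /is_trig_mxP Btrig; apply/is_trig_mxP => i j ij.
rewrite mxE big1// => k _; have [ik|ki] := ltnP i k; first by rewrite Atrig ?mul0r.
by rewrite Btrig ?mulr0// (leq_ltn_trans ki).
Qed.

Lemma mulmx_trig_diag A B i : is_trig_mx A -> is_trig_mx B ->
  (A *m B) i i = A i i * B i i.
Proof.
move=> /is_trig_mxP Atrig /is_trig_mxP Btrig.
rewrite mxE (bigD1 i)//= big1 ?addr0// => k; rewrite neq_ltn => /orP[ki|ik].
  by rewrite Btrig ?mulr0.
by rewrite Atrig ?mul0r.
Qed.

Lemma eigenvalue_trig T a : is_trig_mx T ->
  eigenvalue T a = [exists i, T i i == a].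
Proof.
move=> Ttrig; rewrite eigenvalue_root_char char_poly_trig// rootE horner_prod.
rewrite prodf_seq_eq0; apply/hasP/existsP => [[i _ /=]|[i /eqP Tia]].
  by rewrite hornerXsubC subr_eq0 => /eqP ->; exists i.
by exists i; rewrite ?mem_index_enum//= hornerXsubC Tia subrr.
Qed.

Lemma eigenvalue_similar P A : P \in unitmx ->
  eigenvalue (P *m A *m invmx P) =1 eigenvalue A.
Proof.
have eigenvalueW Q B a : Q \in unitmx ->
    eigenvalue (Q *m B *m invmx Q) a -> eigenvalue B a.
  move=> Qu /eigenvalueP[v vQ v0]; apply/eigenvalueP; exists (v *m Q).
    rewrite scalemxAl -vQ -!mulmxA mulVmx// mulmx1 //.
  by apply: contraNneq v0 => /(congr1 (mulmx^~ (invmx Q))); rewrite mulmxK// mul0mx => ->.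
move=> Pu a; apply/idP/idP; first exact: eigenvalueW.
move=> Aa; apply: (eigenvalueW (invmx P)); first by rewrite unitmx_inv.
by rewrite invmxK !mulmxA mulVmx// mul1mx -!mulmxA mulVmx// mulmx1.
Qed.

Lemma eigenvalue_trmx A : eigenvalue A^T =1 eigenvalue A.
Proof.
move=> a; rewrite !eigenvalue_root_char; congr root.
by rewrite /char_poly -det_tr; congr (\det _); rewrite /char_poly_mx
  linearB/= tr_scalar_mx map_trmx trmxK.
Qed.

End triangular_matrices.

Lemma horner_mx_trig (F : fieldType) n (T : 'M[F]_n.+1) p : is_trig_mx T ->
  is_trig_mx (horner_mx T p) /\ forall i, horner_mx T p i i = p.[T i i].
Proof.
move=> Ttrig; elim/poly_ind: p => [|p c [IHp IHi]].
  rewrite rmorph0; split=> [|i]; last by rewrite mxE horner0.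
  exact: mx0_is_trig.
rewrite rmorphD rmorphM/= horner_mx_X horner_mx_C; split=> [|i].
  apply/is_trig_mxP => i j ij; rewrite mxE.
  rewrite (is_trig_mxP (mulmx_trig IHp Ttrig))// (is_trig_mxP (scalar_mx_is_trig _ _))//.
  by rewrite addr0.
by rewrite mxE mulmx_trig_diag// IHi !hornerE mxE eqxx mulr1n.
Qed.

Lemma schur_trig (C : numClosedFieldType) n (A : 'M[C]_n.+1) :
  exists2 P, P \in unitmx & is_trig_mx (P *m A *m invmx P).
Proof.
have [P Pu Ptrig] := Schur A (ltn0Sn n); exists P; first exact: unitarymx_unit.
by move: Ptrig; rewrite /similar_to conjumx// unitarymx_unit.
Qed.

Section spectral_mapping.
Variables (R : realType) (n : nat).
Implicit Types A : 'M[R]_n.+1.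
Local Notation toC := (real_complex R).
Local Notation normc := Normc.normc.

Lemma mxC_horner_exp_trunc A N :
  mxC (horner_mx A (exp_trunc R N)) = horner_mx (mxC A) (exp_trunc R[i] N).
Proof.
rewrite /mxC map_horner_mx; congr (horner_mx _ _).
apply/polyP => i; rewrite coef_map/= !coef_poly.
by case: ifP => _; rewrite ?rmorph0// fmorphV rmorph_nat.
Qed.

(** Moduli of limits can be computed without a topology on the complex numbers. *)
Lemma normc_cvg_unique (u : nat -> R[i]) (l : R[i]) (r : R) :
  normc (u N - l) @[N --> \oo] --> (0 : R) ->
  normc (u N) @[N --> \oo] --> r -> normc l = r.
Proof.
move=> ul ur; have lr : normc (u N) @[N --> \oo] --> normc l.
  apply/cvgrPdist_le => e e0; near=> N.
  apply: (@le_trans _ _ (normc (u N - l))).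
    have := le_normcD (u N - l) l; have := le_normcD (l - u N) (u N).
    rewrite !subrK -[normc (l - u N)]normcN opprB ler_norml.
    by move=> h1 h2; apply/andP; split; lra.
  by near: N; exact: (cvgr_le _ ul).
exact: (cvg_unique _ lr ur).
Unshelve. all: end_near. Qed.

(** A polynomial in a triangular matrix is triangular, with the values of the
polynomial on its diagonal; both facts survive in the limit of the truncated
exponentials. Diagonal entries are recorded by their moduli, which determine
spectral radii and the absolute value of the determinant. *)
Lemma exp_similar_trig A P : P \in unitmx ->
  is_trig_mx (P *m mxC A *m invmx P) ->
  is_trig_mx (P *m mxC (expmx A) *m invmx P) /\
  forall i, normc ((P *m mxC (expmx A) *m invmx P) i i) =
    expR (complex.Re ((P *m mxC A *m invmx P) i i)).
Proof.
move=> Pu Ttrig.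
have cvP i j := cvg_mulmxC P (invmx P) (u := fun N => horner_mx A (exp_trunc R N))
  (l := expmx A) i j (@cvg_horner_expmx _ _ A).
have hornerP N : P *m mxC (horner_mx A (exp_trunc R N)) *m invmx P =
    horner_mx (P *m mxC A *m invmx P) (exp_trunc R[i] N).
  by rewrite mxC_horner_exp_trunc horner_mx_uconj.
split=> [|i].
  apply/is_trig_mxP => i j ij; apply: Normc.eq0_normc.
  apply: (normc_cvg_unique (cvP i j)).
  under eq_fun do rewrite hornerP (is_trig_mxP (horner_mx_trig _ Ttrig).1)// Normc.normc0.
  exact: cvg_cst.
apply: (normc_cvg_unique (cvP i i)).
under eq_fun do rewrite hornerP (horner_mx_trig _ Ttrig).2.
exact: cvg_normc_exp_trunc.
Qed.

Lemma expmx_eigenvalue A z : eigenvalue (mxC (expmx A)) z ->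
  exists2 l, eigenvalue (mxC A) l & normc z = expR (complex.Re l).
Proof.
have [P Pu Ttrig] := schur_trig (mxC A).
have [Mtrig Md] := exp_similar_trig Pu Ttrig.
rewrite -(eigenvalue_similar (mxC (expmx A)) Pu) eigenvalue_trig// => /existsP[i /eqP <-].
exists ((P *m mxC A *m invmx P) i i); last exact: Md.
rewrite -(eigenvalue_similar (mxC A) Pu) (eigenvalue_trig _ Ttrig).
by apply/existsP; exists i; rewrite eqxx.
Qed.

(** Both sides are products over the diagonal of a triangularisation. *)
Lemma det_expmx A : `|\det (expmx A)| = expR (\tr A).
Proof.
have [P Pu Ttrig] := schur_trig (mxC A).
have [Mtrig Md] := exp_similar_trig Pu Ttrig.
have trT : \tr (P *m mxC A *m invmx P) = toC (\tr A).
  by rewrite mxtrace_mulC mulmxA mulVmx// mul1mx /mxC trace_map_mx.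
have detM : \det (P *m mxC (expmx A) *m invmx P) = toC (\det (expmx A)).
  by rewrite !det_mulmx det_inv mulrAC divrr ?mul1r// /mxC det_map_mx.
rewrite -normc_real -[X in normc X]detM det_trig//.
have -> : normc (\prod_i (P *m mxC (expmx A) *m invmx P) i i) =
    \prod_i normc ((P *m mxC (expmx A) *m invmx P) i i).
  by rewrite (big_morph (@Normc.normc R) (@Normc.normcM R) (@Normc.normc1 R)).
under eq_bigr do rewrite Md.
rewrite -expR_sum; congr expR.
have <- : complex.Re (\tr (P *m mxC A *m invmx P)) = \tr A by rewrite trT.
rewrite /mxtrace (big_morph (@complex.Re R) (id1 := 0) (op1 := +%R))//.
by move=> [a b] [c d].
Qed.

End spectral_mapping.

Section spectral_estimates.
Variables (R : realType) (n : nat).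
Implicit Types A : 'M[R]_n.+1.
Local Notation normc := Normc.normc.

(** An eigenvector [v] of [A] for z satisfies v p(A) = p(z) v for each polynomial
p. In the limit of the truncated exponentials, v exp(A) is the limit of multiples
of [v], hence a multiple; [mu] is read off a nonzero coordinate of [v]. *)
Lemma exp_eigenvector A z : eigenvalue (mxC A) z ->
  exists v : 'rV[R[i]]_n.+1, exists mu : R[i],
    [/\ v != 0, v *m mxC (expmx A) = mu *: v & normc mu = expR (complex.Re z)].
Proof.
move=> /eigenvalueP[v vA v0].
pose w := v *m mxC (expmx A).
pose s N := (exp_trunc R[i] N).[z].
have vs N : v *m mxC (horner_mx A (exp_trunc R N)) = s N *: v.
  rewrite mxC_horner_exp_trunc /s; elim/poly_ind: (exp_trunc _ N) => [|p c IHp].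
    by rewrite rmorph0 mulmx0 horner0 scale0r.
  rewrite rmorphD rmorphM/= horner_mx_X horner_mx_C mulmxDr mulmxA IHp.
  by rewrite -scalemxAl vA mul_mx_scalar scalerA -scalerDl !hornerE.
have cvw j : normc (s N * v ord0 j - w ord0 j) @[N --> \oo] --> (0 : R).
  have -> : (fun N => normc (s N * v ord0 j - w ord0 j)) = fun N =>
      normc ((v *m mxC (horner_mx A (exp_trunc R N)) *m 1%:M) ord0 j -
             (v *m mxC (expmx A) *m 1%:M) ord0 j).
    by apply/funext => N; rewrite !mulmx1 vs [(s N *: v) _ _]mxE.
  exact: (cvg_mulmxC v 1%:M ord0 j (@cvg_horner_expmx _ _ A)).
have [i vi] : exists i, v ord0 i != 0.
  apply/existsP; apply: contraNT v0; rewrite negb_exists => /forallP v0.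
  by apply/eqP/rowP => i; rewrite mxE; apply/eqP; have := v0 i; rewrite negbK.
exists v, (w ord0 i / v ord0 i); split => //.
  apply/rowP => j; rewrite -/w [RHS]mxE.
  apply: (mulIf vi); rewrite mulrAC divfK//.
  apply/eqP; rewrite -subr_eq0; apply/eqP/Normc.eq0_normc.
  pose e N := normc (s N * v ord0 i - w ord0 i) * normc (v ord0 j) +
    normc (s N * v ord0 j - w ord0 j) * normc (v ord0 i).
  have e0 : e N @[N --> \oo] --> (0 : R).
    have := cvgD (cvgM (cvw i) (@cvg_cst _ (normc (v ord0 j)) nat \oo _))
      (cvgM (cvw j) (@cvg_cst _ (normc (v ord0 i)) nat \oo _)).
    by rewrite !mul0r addr0; exact.
  apply/eqP; rewrite eq_le normc_ge0 andbT.
  have ce : (fun=> normc (w ord0 j * v ord0 i - w ord0 i * v ord0 j)) @ \oo -->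
    normc (w ord0 j * v ord0 i - w ord0 i * v ord0 j) by exact: cvg_cst.
  apply: (ler_cvg_to ce e0).
  near=> N; rewrite /e -!Normc.normcM.
  have -> : w ord0 j * v ord0 i - w ord0 i * v ord0 j =
    (s N * v ord0 i - w ord0 i) * v ord0 j - (s N * v ord0 j - w ord0 j) * v ord0 i.
    by ring.
  by rewrite -[X in _ <= _ + X]normcN; exact: le_normcD.
have nvi : normc (v ord0 i) != 0 by apply: contra vi => /eqP/Normc.eq0_normc ->.
apply: (mulIf nvi); rewrite -Normc.normcM divfK//.
apply: (normc_cvg_unique (cvw i)).
under eq_fun do rewrite Normc.normcM.
by apply: cvgM; [exact: cvg_normc_exp_trunc|exact: cvg_cst].
Unshelve. all: end_near. Qed.

(** Triangularise [A] and weight the j-th coordinate by B^j. Below the diagonal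
each term then loses a factor B, so for large B the weighted row sums of the
triangular matrix are at most [r], and this bound is multiplicative. *)
Lemma spectral_radius_bound A (rho r : R) :
  (forall z, eigenvalue (mxC A) z -> normc z <= rho) -> 0 < r -> rho < r ->
  exists C : R, forall k i j, `|(A ^+ k) i j| <= C * r ^+ k.
Proof.
move=> Arho r0 rhor.
have [P Pu] := schur_trig (mxC A); set T := _ *m _ => Ttrig.
have Td i : normc (T i i) <= rho.
  apply: Arho; rewrite -(eigenvalue_similar _ Pu) (eigenvalue_trig _ Ttrig).
  by apply/existsP; exists i; rewrite eqxx.
(* B is chosen so that S <= B (r - rho): one factor B absorbs all off-diagonal
   entries. *)
pose S := \sum_i \sum_j normc (T i j).
have S0 : 0 <= S by apply: sumr_ge0 => i _; apply: sumr_ge0 => j _; exact: normc_ge0.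
pose B := 1 + S / (r - rho).
have B1 : 1 <= B by rewrite lerDl divr_ge0// subr_ge0 ltW.
have B0 : 0 < B by exact: lt_le_trans B1.
have SB : S <= B * (r - rho).
  by rewrite mulrDl divfK ?gt_eqF ?subr_gt0// mul1r lerDr subr_ge0 ltW.
have rowT i : \sum_j normc (T i j) * B ^+ j <= r * B ^+ i.
  rewrite (bigD1 i)//=.
  have -> : r * B ^+ i = rho * B ^+ i + (r - rho) * B ^+ i by ring.
  apply: lerD; first by rewrite ler_wpM2r// exprn_ge0// ltW.
  rewrite -(ler_pM2l B0) mulrA.
  apply: (@le_trans _ _ (S * B ^+ i)); last by rewrite ler_wpM2r// exprn_ge0// ltW.
  apply: (@le_trans _ _ ((\sum_j normc (T i j)) * B ^+ i)); last first.
    apply: ler_wpM2r; first by rewrite exprn_ge0 ?ltW.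
    rewrite /S [leRHS](bigD1 i)//= lerDl.
    by apply: sumr_ge0 => k _; apply: sumr_ge0 => j _; exact: normc_ge0.
  rewrite mulr_sumr mulr_suml [leRHS](bigD1 i)//=.
  rewrite -[leLHS]add0r; apply: lerD.
    by rewrite mulr_ge0 ?normc_ge0// exprn_ge0// ltW.
  apply: ler_sum => j; rewrite neq_ltn => /orP[ji|ij].
    by rewrite mulrCA; apply: ler_wpM2l; [exact: normc_ge0|rewrite -exprS ler_weXn2l].
  by rewrite (is_trig_mxP Ttrig)// Normc.normc0 !(mul0r, mulr0).
pose K i j := \sum_l \sum_k normc (invmx P i k) * normc (P l j).
have K0 i j : 0 <= K i j.
  by apply: sumr_ge0 => l _; apply: sumr_ge0 => k _; rewrite mulr_ge0 ?normc_ge0.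
pose T' k := P *m mxC (A ^+ k) *m invmx P.
have T'S k : T' k.+1 = T *m T' k.
  rewrite /T' /T exprS -mulmxE /mxC map_mxM -/(mxC _) -/(mxC _) !mulmxA.
  by rewrite mulmxKV.
have T'0 : T' 0 = 1%:M by rewrite /T' expr0 /mxC map_mx1 mulmx1 mulmxV.
have AT' k i j : `|(A ^+ k) i j| = normc ((invmx P *m T' k *m P) i j).
  by rewrite /T' !mulmxA mulVmx// mul1mx mulmxKV// mxE normc_real.
clearbody T' T.
have rowTk k i : \sum_j normc (T' k i j) * B ^+ j <= r ^+ k * B ^+ i.
  elim: k i => [|k IHk] i.
    rewrite T'0 expr0 (bigD1 i)//= big1 => [|j ji].
      by rewrite addr0 mxE eqxx Normc.normc1.
    by rewrite mxE eq_sym (negbTE ji) Normc.normc0 mul0r.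
  rewrite T'S exprS.
  apply: (@le_trans _ _ (\sum_l normc (T i l) * \sum_j normc (T' k l j) * B ^+ j)).
    have -> : \sum_l normc (T i l) * \sum_j normc (T' k l j) * B ^+ j =
        \sum_j (\sum_l normc (T i l * T' k l j)) * B ^+ j.
      rewrite (eq_bigr (fun l => \sum_j normc (T i l * T' k l j) * B ^+ j)).
        by rewrite exchange_big/=; apply: eq_bigr => j _; rewrite mulr_suml.
      by move=> l _; rewrite mulr_sumr; apply: eq_bigr => j _; rewrite Normc.normcM mulrA.
    apply: ler_sum => j _; apply: ler_wpM2r; first by rewrite exprn_ge0// ltW.
    by rewrite mxE; exact: ler_normc_sum.
  apply: (@le_trans _ _ (\sum_l normc (T i l) * (r ^+ k * B ^+ l))).
    by apply: ler_sum => l _; apply: ler_wpM2l; [exact: normc_ge0|exact: IHk].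
  under eq_bigr do rewrite mulrCA.
  rewrite -mulr_sumr [r * _]mulrC -mulrA; apply: ler_wpM2l; last exact: rowT.
  by rewrite exprn_ge0// ltW.
have entTk k i j : normc (T' k i j) <= r ^+ k * B ^+ n.
  apply: (@le_trans _ _ (\sum_j normc (T' k i j) * B ^+ j)).
    rewrite (bigD1 j)//=; apply: (@le_trans _ _ (normc (T' k i j) * B ^+ j)).
      by rewrite ler_peMr ?normc_ge0// exprn_ege1.
    by rewrite lerDl sumr_ge0// => l _; rewrite mulr_ge0 ?normc_ge0 ?exprn_ge0 ?ltW.
  apply: (le_trans (rowTk _ _)).
  by apply: ler_wpM2l; [rewrite exprn_ge0// ltW|rewrite ler_weXn2l// -ltnS].
exists (B ^+ n * \sum_i \sum_j K i j) => k i j; rewrite AT'.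
apply: (le_trans (normc_mulmx2 _ _ _ _ (entTk k))); rewrite -/(K i j).
clearbody K.
rewrite [leRHS]mulrAC [B ^+ n * _]mulrC [leRHS]mulrC; apply: ler_wpM2r.
  by rewrite mulr_ge0// exprn_ge0// ltW.
rewrite (bigD1 i)//= (bigD1 j)//= -addrA lerDl addr_ge0//.
  by apply: sumr_ge0.
by apply: sumr_ge0 => i' _; exact: sumr_ge0.
Qed.

End spectral_estimates.

Section exponential_decay.
Variables (R : realType) (n : nat) (A : 'M[R]_n.+1).
Local Notation normc := Normc.normc.

Lemma expmx_unitmx : expmx A \in unitmx.
Proof.
by rewrite unitmxE unitfE -normr_eq0 det_expmx gt_eqF// expR_gt0.
Qed.

(** An eigenvalue of exp(A)^-1 is the inverse of one of exp(A), so its modulus is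
e^(- Re l) <= e^(- a) for some eigenvalue l of [A]. *)
Lemma expmx_inv_decay (a b : R) :
  (forall z, ceigenvalue A z -> a <= complex.Re z) -> b < a ->
  exists C : R, forall k i j, `|(invmx (expmx A) ^+ k) i j| <= C * expR (- b) ^+ k.
Proof.
move=> Aa ba; apply: (@spectral_radius_bound _ _ _ (expR (- a))); last 2 first.
- exact: expR_gt0.
- by rewrite ltr_expR ltrN2.
move=> z /eigenvalueP[v vM v0].
have Mu : mxC (expmx A) \in unitmx by rewrite /mxC map_unitmx expmx_unitmx.
have vz : v = z *: (v *m mxC (expmx A)).
  by rewrite scalemxAl -vM /mxC map_invmx -/(mxC _) mulmxKV.
have z0 : z != 0 by apply: contraNneq v0 => z0; rewrite vz z0 scale0r.
have [|l /Aa al zl] := @expmx_eigenvalue _ _ A z^-1.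
  by apply/eigenvalueP; exists v => //; rewrite [in RHS]vz scalerA mulVf// scale1r.
by rewrite -[normc z]invrK -Normc.normcV zl -expRN ler_expR lerN2.
Qed.

End exponential_decay.

Lemma expmx_inv_norm_decay (R : realType) n (E : 'M[R]_n.+1) (a b : R) :
  (forall z, ceigenvalue E z -> a <= complex.Re z) -> b < a ->
  exists C : R, forall k, `|invmx (expmx E) ^+ k| <= C * expR (- b) ^+ k.
Proof.
move=> Ea ba; have [C hC] := expmx_inv_decay Ea ba.
exists C => k; apply: ler_mx_norm => [|i j]; last exact: hC.
exact: (le_trans (normr_ge0 _) (hC k ord0 ord0)).
Qed.

(** * Topology and measurability of column vectors *)

Section column_vectors.
Variables (R : realType) (n : nat).
Implicit Types (v w : 'cV[R]_n) (U K : set 'cV[R]_n).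
Local Notation leb := (lebesgue_cV R n).

Definition cube v e : set 'cV[R]_n :=
  [set w | forall i, (w i ord0) \in `]v i ord0 - e, v i ord0 + e[].

Lemma measurable_cube v e : measurable (cube v e).
Proof.
rewrite (_ : cube v e = \bigcap_(i in [set: 'I_n])
    ((fun w : 'cV[R]_n => w i ord0) @^-1` `]v i ord0 - e, v i ord0 + e[)).
  apply: fin_bigcap_measurable; first exact: finite_finset.
  by move=> i _; rewrite -[X in measurable X]setTI; exact: measurable_coord.
by apply/seteqP; split => [w vw i _|w vw i]; [exact: vw|exact: (vw i)].
Qed.

Lemma cubeP v e w : 0 < e -> cube v e w <-> `|v - w| < e.
Proof.
move=> e0; split=> [vw|vw i].
  rewrite /Num.norm/= mx_normrE; apply: bigmax_lt => // -[i j] _ /=.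
  rewrite !mxE (ord1 j) distrC ltr_distl.
  by have := vw i; rewrite in_itv.
rewrite in_itv/= -ltr_distl distrC.
by apply: le_lt_trans vw; have := ler_mx_entry (v - w) i ord0; rewrite !mxE.
Qed.

Lemma lebesgue_cube v e : 0 < e -> leb (cube v e) = ((e *+ 2) ^+ n)%:E.
Proof.
move=> e0.
rewrite -[LHS]/(leb [set w : 'cV[R]_n | forall i : 'I_n,
  `]v i ord0 - e, v i ord0 + e[%classic (w i ord0)]).
rewrite (lebesgue_cV_box (A := fun i => `]v i ord0 - e, v i ord0 + e[%classic))//.
rewrite (eq_bigr (fun=> (e *+ 2)%:E)) => [|i _].
  by rewrite prodEFin prodr_const card_ord.
rewrite lebesgue_measure_itv/= lte_fin ltrD2l gtrN// -EFinB.
by congr EFin; ring.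
Qed.

(** The sigma-algebra is generated by the coordinates, so openness is exploited
through countably many cubes with rational centres and radii 1 / (m + 1). *)
Lemma open_measurable_cV U : open U -> measurable U.
Proof.
move=> oU.
pose q2v (q : {ffun 'I_n -> rat}) : 'cV[R]_n := \col_i ratr (q i).
pose F (x : {ffun 'I_n -> rat} * nat) : set 'cV[R]_n :=
  if `[< cube (q2v x.1) x.2.+1%:R^-1 `<=` U >] then cube (q2v x.1) x.2.+1%:R^-1
  else set0.
have -> : U = \bigcup_x F x.
  apply/seteqP; split=> [v Uv|v [x _]]; last first.
    by rewrite /F; case: ifPn => // /asboolP; apply.
  have /nbhs_ballP[e /= e0 veU] : nbhs v U by exact: open_nbhs_nbhs.
  pose m := Num.truncn (2 / e).
  have m0 : (0 : R) < m.+1%:R^-1 by rewrite invr_gt0.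
  have me : m.+1%:R^-1 < e / 2.
    by rewrite -[e / 2]invrK ltf_pV2 ?posrE// ?invr_gt0 ?divr_gt0// invf_div truncnS_gt.
  have h i : exists q : rat, `|v i ord0 - ratr q| < m.+1%:R^-1.
    have [|q] := @rat_in_itvoo R (v i ord0 - m.+1%:R^-1) (v i ord0 + m.+1%:R^-1).
      by rewrite ltrD2l gtrN.
    by rewrite in_itv/= -ltr_distl distrC => vq; exists q.
  have [g gP] := choice h.
  have vg : `|q2v (finfun g) - v| < m.+1%:R^-1.
    rewrite /Num.norm/= mx_normrE; apply: bigmax_lt => // -[i j] _ /=.
    by rewrite !mxE ffunE (ord1 j) distrC.
  exists (finfun g, m) => //; rewrite /F/= asboolT; first by apply/cubeP.
  move=> w /cubeP-/(_ m0) gw; apply: veU; rewrite -ball_normE/=.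
  rewrite -[v - w](subrKA (q2v (finfun g))).
  apply: (le_lt_trans (ler_normD _ _)); rewrite (splitr e) ltrD//.
    by rewrite distrC (lt_trans vg).
  by rewrite (lt_trans gw).
apply: countable_bigcupT_measurable; first exact/countableP.
by move=> x; rewrite /F; case: ifPn => _; [exact: measurable_cube|exact: measurable0].
Qed.

Lemma continuous_measurable_cV (f : 'cV[R]_n -> R) :
  continuous f -> measurable_fun setT f.
Proof.
move=> cf; apply: (measurability _ (RGenOpens.measurableE R)).
move=> _ [_ [a [b ->] <-]]; rewrite setTI; apply: open_measurable_cV.
by apply: open_comp => [v _|]; [exact: cf|exact: interval_open].
Qed.

Lemma continuous_trmx p q : continuous (fun A : 'M[R]_(p, q) => A^T).
Proof. by move=> A; apply: (@cvg_trmx _ _ (nbhs A) (nbhs_filter A)); exact: cvg_id. Qed.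

(** Transported from row vectors by the homeomorphism of transposition. *)
Lemma bounded_closed_compact_cV K : bounded_set K -> closed K -> compact K.
Proof.
move=> [M [Mr KM]] cK.
pose tr (v : 'rV[R]_n) : 'cV[R]_n := v^T.
have ctr : continuous tr by exact: continuous_trmx.
have -> : K = tr @` (tr @^-1` K).
  apply/seteqP; split=> [v Kv|_ [v Kv <-]//].
  by exists v^T; rewrite /tr /= trmxK.
apply: continuous_compact; first exact: continuous_subspaceT.
apply: bounded_closed_compact; last exact: closed_comp.
exists M; split=> // x Mx v Kv; apply: le_trans (KM _ Mx _ Kv).
apply: ler_mx_norm => // i j.
by have := ler_mx_entry (tr v) j i; rewrite mxE.
Qed.

Lemma continuous_mulmx m (A : 'M[R]_(m, n)) : continuous (fun v : 'cV[R]_n => A *m v).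
Proof.
move=> v; apply/(@cvgrPdist_le _ _ _ (nbhs v) (nbhs_filter v)) => e e0.
pose C := n%:R * `|A| + 1.
have C0 : 0 < C by rewrite ltr_wpDl// mulr_ge0.
near=> w; rewrite -mulmxBr; apply: (le_trans (ler_normM_mulmx _ _)).
apply: (@le_trans _ _ (C * `|v - w|)); first by rewrite ler_wpM2r// lerDl.
rewrite -ler_pdivlMl//; near: w; apply: cvgr_dist_le; first exact: cvg_id.
by rewrite mulr_gt0// invr_gt0.
Unshelve. all: end_near. Qed.

End column_vectors.

(** * Trigonometric estimates *)

Section trigonometric_estimates.
Variable R : realType.
Implicit Types x t : R.
Local Notation normc := Normc.normc.

Lemma sin_mean_value x : 0 < x -> exists2 c, 0 < c < x & sin x = x * cos c.
Proof.
move=> x0.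
have [c] := @MVT R sin cos 0 x x0 (fun x _ => is_derive_sin x)
  (continuous_subspaceT (@continuous_sin R)).
by rewrite in_itv/= sin0 !subr0 mulrC => cx ->; exists c.
Qed.

Lemma norm_sin_le x : `|sin x| <= `|x|.
Proof.
wlog x0 : x / 0 < x => [hwlog|].
  have [x0|x0|->] := ltgtP x 0; last by rewrite sin0 normr0.
    by have := hwlog (- x); rewrite sinN !normrN oppr_gt0; exact.
  exact: hwlog.
have [c _ ->] := sin_mean_value x0.
by rewrite normrM ler_piMr// cos_max.
Qed.

Lemma oneBcosE x : 1 - cos x = 2 * sin (x / 2) ^+ 2.
Proof.
have -> : cos x = cos ((x / 2) *+ 2) by rewrite -mulr_natr divfK.
by rewrite cos_mulr2n cos2sin2; ring.
Qed.

Lemma oneBcos_le x : 1 - cos x <= `|x|.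
Proof.
have := norm_sin_le (x / 2); have := sin_max (x / 2).
rewrite oneBcosE normrM [`|2^-1|]ger0_norm// -(real_normK (num_real (sin _))).
by have := normr_ge0 (sin (x / 2)); nra.
Qed.

Lemma oneBcos_le_sqr x : 2 * (1 - cos x) <= x ^+ 2.
Proof.
have := norm_sin_le (x / 2).
rewrite oneBcosE normrM [`|2^-1|]ger0_norm//.
rewrite -(real_normK (num_real (sin _))) -(real_normK (num_real x)).
by have := normr_ge0 (sin (x / 2)); nra.
Qed.

Lemma norm_sin_ge x : `|x| <= 1 -> `|x| / 2 <= `|sin x|.
Proof.
wlog x0 : x / 0 < x => [hwlog|x1].
  have [x0|x0|->] := ltgtP x 0; last by rewrite sin0 normr0 mul0r.
    by move=> x1; have := hwlog (- x); rewrite sinN !normrN oppr_gt0; exact.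
  exact: hwlog.
have [c /andP[c0 cx] ->] := sin_mean_value x0.
rewrite normrM ler_wpM2l//; apply: le_trans (ler_norm _).
have := oneBcos_le_sqr c; rewrite gtr0_norm// in x1; nra.
Qed.

Lemma normc_cexpiB1 t : normc (cexpi t - 1) ^+ 2 = 2 * (1 - cos t).
Proof.
rewrite /= sqr_sqrtr ?addr_ge0 ?sqr_ge0// subr0 sin2cos2; ring.
Qed.

Lemma normc_cexpiB1_le2 t : normc (cexpi t - 1) <= 2.
Proof.
rewrite -(@ler_pXn2r _ 2)// ?nnegrE ?normc_ge0// normc_cexpiB1.
by have := cos_geN1 t; lra.
Qed.

Lemma normc_cexpiB1_le t : normc (cexpi t - 1) <= `|t|.
Proof.
rewrite -(@ler_pXn2r _ 2)// ?nnegrE ?normc_ge0// normc_cexpiB1.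
by rewrite real_normK ?num_real//; exact: oneBcos_le_sqr.
Qed.

Lemma normc_cexpiB1_ge t : `|t| <= 1 -> `|t| / 2 <= normc (cexpi t - 1).
Proof.
move=> /norm_sin_ge t1; apply: (le_trans t1).
rewrite -(@ler_pXn2r _ 2)// ?nnegrE ?normc_ge0// normc_cexpiB1.
rewrite real_normK ?num_real// sin2cos2.
by have := sqr_ge0 (1 - cos t); lra.
Qed.

End trigonometric_estimates.

(** * Characteristic functions and concentration *)

Section concentration.
Context (R : realType) (dT : measure_display) (T : measurableType dT).
Variables (P : probability T R) (Y : T -> R).
Hypothesis mY : measurable_fun setT Y.
Local Notation mu := (@lebesgue_measure R).

(** The sine term is at most 1 / |y| in absolute value, so this average detects
large values of |y|. *)
Lemma integral_oneBcos (y d : R) : 0 < d -> y != 0 ->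
  (\int[mu]_(t in `[0%R, d]) (1 - cos (y * t))%:E = (d - y^-1 * sin (y * d))%:E)%E.
Proof.
move=> d0 y0.
pose F (t : R) := t - y^-1 * sin (y * t).
have dF (t : R) : is_derive t 1 F (1 - cos (y * t)).
  have d1 : is_derive t 1 (fun t : R => y * t) y.
    by apply: is_derive_eq; rewrite /GRing.scale/= mulr1.
  have d2 := @is_derive1_comp _ sin (fun t : R => y * t) t _ _ (is_derive_sin _) d1.
  have d3 := is_deriveB (is_derive_id t 1) (is_deriveZ y^-1 d2).
  by apply: (is_derive_eq d3); rewrite /GRing.scale/=; field.
have cF : continuous F.
  by move=> t; apply/differentiable_continuous/derivable1_diffP/ex_derive.
rewrite (@continuous_FTC2 _ (fun t => 1 - cos (y * t)) F).
- by rewrite /F !mulr0 sin0 mulr0 subr0 sube0.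
- exact: d0.
- apply: continuous_subspaceT => t; apply: cvgB; first exact: cvg_cst.
  apply: (continuous_comp (f := fun t => y * t) (g := cos)); last exact: continuous_cos.
  by apply: cvgMr; exact: cvg_id.
- split=> [t _||]; first exact: ex_derive.
    by apply: cvg_at_right_filter; exact: cF.
  by apply: cvg_at_left_filter; exact: cF.
- by move=> t _; rewrite derive1E derive_val.
Qed.

Lemma measurable_oneBcos :
  measurable_fun [set: T * measurableTypeR R]
    (fun z => 1 - cos (z.2 * Y z.1)).
Proof.
apply: measurable_funB => //.
apply: (measurableT_comp (f := cos)).
  by apply: continuous_measurable_fun; exact: continuous_cos.
apply: measurable_funM; first exact: measurable_snd.
exact: (measurableT_comp mY measurable_fst).
Qed.

Lemma measurable_cosY (t : R) : measurable_fun setT (fun w => cos (t * Y w)).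
Proof.
apply: (measurableT_comp (f := cos)).
  by apply: continuous_measurable_fun; exact: continuous_cos.
exact: measurable_funM.
Qed.

Lemma integral_cos (t : R) :
  (\int[P]_w (1 - cos (t * Y w))%:E = (1 - complex.Re (charfun P Y t))%:E)%E.
Proof.
have icos : P.-integrable setT (EFin \o (fun w => cos (t * Y w))).
  apply: measurable_bounded_integrable => //.
  - exact: fin_num_fun_lty.
  - exact: measurable_cosY.
  - exists 1; split=> // x x1 w _ /=; exact: le_trans (cos_max _) (ltW x1).
have i1 : P.-integrable setT (EFin \o (fun=> 1 : R)).
  by apply: finite_measure_integrable_cst.
rewrite /charfun/= /Rintegral.
rewrite EFinB fineK; last exact: integrable_fin_num.
have c1 : (\int[P]_w cst (1 : R)%:E w = 1%:E)%E.
  by rewrite integral_cst//= probability_setT mule1.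
rewrite -[X in (X - _)%E]c1.
exact: (integralB_EFin measurableT i1 icos).
Qed.

Lemma measurable_absY e : measurable [set w | (e < `|Y w|)%R].
Proof.
have := measurableT_comp (@normr_measurable R setT) mY.
move=> /(_ measurableT _ (measurable_itv `]e, +oo[)); rewrite setTI.
by congr measurable; apply/seteqP; split => w /=; rewrite in_itv/= andbT.
Qed.

(** Integrate 1 - cos(t Y) over t between 0 and 2 / e. Where |Y| > e the integral
is at least 2 / e - 1 / e, while by Tonelli its expectation is the integral of 1 -
Re(charfun t). *)
Lemma concentration_charfun (e c : R) : 0 < e ->
  (forall t, 0 <= t <= 2 / e -> c <= complex.Re (charfun P Y t)) ->
  (P [set w | (e < `|Y w|)%R] <= (2 * (1 - c))%:E)%E.
Proof.
move=> e0 cY.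
set S := [set w | _]; set d := 2 / e.
have d0 : 0 < d by rewrite divr_gt0.
pose D : set R := `[0%R, d]%classic.
pose f (z : T * measurableTypeR R) := ((1 - cos (z.2 * Y z.1)) * \1_D z.2)%:E.
have mf : measurable_fun setT f.
  apply/measurable_EFinP; apply: measurable_funM; first exact: measurable_oneBcos.
  have mD : measurable_fun setT (\1_D : measurableTypeR R -> R).
    by apply: measurable_indic; exact: measurable_itv.
  exact: (measurableT_comp mD measurable_snd).
have f0 z : (0 <= f z)%E.
  by rewrite lee_fin mulr_ge0// subr_ge0 cos_le1.
have fD w : (\int[mu]_t f (w, t) = \int[mu]_(t in D) (1 - cos (t * Y w))%:E)%E.
  rewrite [RHS]integral_mkcond; apply: eq_integral => t _.
  by rewrite /f patchE indicE; case: ifP => _; rewrite ?mulr1 ?mulr0.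
have lowS : ((e^-1)%:E * P S <= \int[P]_w \int[mu]_t f (w, t))%E.
  rewrite -(setIT S) -integral_indic//; last exact: measurable_absY.
  rewrite -ge0_integralZl//; last 2 first.
  - by apply/measurable_EFinP; apply: measurable_indic; exact: measurable_absY.
  - by rewrite lee_fin invr_ge0 ltW.
  apply: ge0_le_integral => //.
  - by move=> w _; rewrite mule_ge0// lee_fin// invr_ge0 ltW.
  - apply: measurable_funeM; apply/measurable_EFinP; apply: measurable_indic.
    exact: measurable_absY.
  - exact: (measurable_fun_fubini_tonelli_F _ mf).
  move=> w _; rewrite indicE; have [|_] := boolP (w \in S); last first.
    by rewrite mule0; apply: integral_ge0.
  rewrite inE /S/= mule1 fD => eY.
  have y0 : Y w != 0 by rewrite -normr_gt0 (lt_trans e0).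
  under eq_integral do rewrite mulrC.
  rewrite integral_oneBcos// lee_fin.
  have : `|(Y w)^-1 * sin (Y w * d)| <= e^-1.
    rewrite normrM normfV -[leRHS]mulr1; apply: ler_pM => //.
      by rewrite lef_pV2 ?posrE ?normr_gt0// ltW.
    exact: sin_max.
  by rewrite ler_norml => /andP[_ h]; rewrite /d; lra.
have upS : (\int[mu]_t \int[P]_w f (w, t) <= (d * (1 - c))%:E)%E.
  have c1 : c <= 1.
    have := cY 0; rewrite lexx ltW// => /(_ isT) c0; apply: (le_trans c0).
    have := integral_cos 0.
    under eq_integral do rewrite mul0r cos0 subrr.
    by rewrite integral0 => /eqP; rewrite eqe eq_sym subr_eq0 => /eqP <-.
  have -> : ((d * (1 - c))%:E = \int[mu]_t ((1 - c)%:E * (\1_D t)%:E))%E.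
    rewrite ge0_integralZl//; last 2 first.
    - apply/measurable_EFinP; apply: measurable_indic; exact: measurable_itv.
    - by rewrite lee_fin subr_ge0.
    rewrite integral_indic//; last exact: measurable_itv.
    rewrite setIT [X in (_ * X)%E](_ : _ = d%:E) -?EFinM 1?mulrC//.
    by rewrite /D/= lebesgue_measure_itv/= lte_fin d0 sube0.
  apply: ge0_le_integral => //.
  - by move=> t _; exact: integral_ge0.
  - exact: (measurable_fun_fubini_tonelli_G _ mf).
  - apply: measurable_funeM; apply/measurable_EFinP; apply: measurable_indic.
    exact: measurable_itv.
  move=> t _; rewrite /f indicE; have [tD|tD] := boolP (t \in D).
    under eq_integral do rewrite mulr1.
    rewrite integral_cos mule1 lee_fin lerD2l lerN2 cY//.
    by move: tD; rewrite inE /D/= in_itv.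
  under eq_integral do rewrite mulr0.
  by rewrite integral0 mule0.
have e10 : (0 < (e^-1)%:E)%E by rewrite lte_fin invr_gt0.
rewrite -(@lee_pmul2l _ (e^-1)%:E)//; apply: (le_trans lowS).
rewrite (fubini_tonelli _ mf)//; apply: (le_trans upS).
by rewrite -EFinM lee_fin /d mulrA [_ * 2]mulrC.
Qed.

(** Bound 1 - cos(Y) by |Y| <= e off the event and by 2 on it. *)
Lemma charfun_concentration (e : R) : 0 <= e ->
  ((1 - complex.Re (charfun P Y 1))%:E <= e%:E + 2%:E * P [set w | (e < `|Y w|)%R])%E.
Proof.
move=> e0; set S := [set w | _].
have mS : measurable S by exact: measurable_absY.
have mSi : measurable_fun setT (fun w => (2%:E * (\1_S w)%:E : \bar R)%E).
  by apply: measurable_funeM; apply/measurable_EFinP; exact: measurable_indic.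
have -> : (e%:E + 2%:E * P S = \int[P]_w (e%:E + 2%:E * (\1_S w)%:E))%E.
  rewrite ge0_integralD//.
  rewrite (integral_cst _ _ e%:E)//= probability_setT mule1.
  rewrite ge0_integralZl//; last exact/measurable_EFinP/measurable_indic.
  by rewrite integral_indic// setIT.
rewrite -integral_cos; apply: ge0_le_integral => //.
- by apply/measurable_EFinP; apply: measurable_funB => //; exact: measurable_cosY.
- by apply: emeasurable_funD.
move=> w _; rewrite mul1r indicE -EFinM -EFinD lee_fin.
have [_|/negP wS] := boolP (w \in S).
  by have := cos_geN1 (Y w); rewrite mulr1; lra.
rewrite mulr0 addr0; apply: (le_trans (oneBcos_le _)).
by rewrite leNgt; apply/negP => h; apply: wS; rewrite inE.
Qed.

End concentration.

(** * The control integral and its scaling *)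

Section dot_product.
Variables (R : realType) (n : nat).
Implicit Types x y xi : 'cV[R]_n.

Lemma dotv_mulmx (A : 'M[R]_n) x xi : dotv x (A^T *m xi) = dotv (A *m x) xi.
Proof.
have dotvE u w : dotv u w = (u^T *m w) ord0 ord0.
  by rewrite mxE; apply: eq_bigr => i _; rewrite mxE.
by rewrite !dotvE trmx_mul mulmxA.
Qed.

Lemma dotv0 x : dotv x 0 = 0.
Proof. by rewrite /dotv big1// => i _; rewrite mxE mulr0. Qed.

Lemma dotvBl x y xi : dotv (x - y) xi = dotv x xi - dotv y xi.
Proof.
by rewrite /dotv -sumrB; apply: eq_bigr => i _; rewrite !mxE mulrBl.
Qed.

Lemma dotvv_gt0 x : x != 0 -> 0 < dotv x x.
Proof.
move=> x0; have [i xi] : exists i, x i ord0 != 0.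
  apply/existsP; apply: contraNT x0; rewrite negb_exists => /forallP x0.
  by apply/eqP/colP => i; rewrite mxE; apply/eqP; have := x0 i; rewrite negbK.
rewrite /dotv (bigD1 i)//= ltr_pwDl//; first by rewrite -expr2 exprn_even_gt0.
by apply: sumr_ge0 => j _; rewrite -expr2 sqr_ge0.
Qed.

(** The norm of matrices is the maximum norm, whence the factor [n]. *)
Lemma dotv_le x xi : `|dotv x xi| <= n%:R * `|x| * `|xi|.
Proof.
apply: (le_trans (ler_norm_sum _ _ _)).
apply: (@le_trans _ _ (\sum_(i < n) `|x| * `|xi|)).
  by apply: ler_sum => i _; rewrite normrM ler_pM// ler_mx_entry.
by rewrite sumr_const card_ord -mulrA mulr_natl.
Qed.

Lemma continuous_dotv x : continuous (dotv x).
Proof.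
have -> : dotv x = fun xi => (x^T *m xi) ord0 ord0.
  by apply/funext => xi; rewrite mxE; apply: eq_bigr => i _; rewrite mxE.
move=> xi; apply: (continuous_comp (f := fun xi : 'cV[R]_n => x^T *m xi)
  (g := fun A : 'M[R]_1 => A ord0 ord0)); first exact: continuous_mulmx.
exact: (@coord_continuous R 1 1 ord0 ord0).
Qed.

Lemma measurable_dotv x : measurable_fun setT (dotv x).
Proof. by apply: continuous_measurable_cV; exact: continuous_dotv. Qed.

End dot_product.

Section kernel.
Variables (R : realType) (n : nat) (E : 'M[R]_n.+1) (psi : 'cV[R]_n.+1 -> R).
Variables (alpha H : R).
Hypotheses (psi_ge0 : forall x, 0 <= psi x) (psi_cont : continuous psi).
Hypothesis (psi_homog : mx_homogeneous E^T psi).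
Hypothesis (alpha0 : 0 < alpha).
Local Notation normc := Normc.normc.
Local Notation M := (expmx E).

Let p := - H - \tr E / alpha.

Definition density (x xi : 'cV[R]_n.+1) : R :=
  (normc (cexpi (dotv x xi) - 1) * psi xi `^ p) `^ alpha.

Lemma normc_harmonizable_kernel x xi :
  normc (harmonizable_kernel E psi alpha H x xi) `^ alpha = density x xi.
Proof.
by rewrite /harmonizable_kernel Normc.normcM normc_real ger0_norm// powR_ge0.
Qed.

Lemma density_ge0 x xi : 0 <= density x xi.
Proof. exact: powR_ge0. Qed.

Lemma density_le x xi u S : normc (cexpi (dotv x xi) - 1) <= u ->
  psi xi `^ p <= S -> density x xi <= (u * S) `^ alpha.
Proof.
move=> xu pS; have u0 : 0 <= u := le_trans (normc_ge0 _) xu.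
have S0 : 0 <= S := le_trans (powR_ge0 _ _) pS.
apply: (ge0_ler_powR (ltW alpha0)); rewrite ?nnegrE.
- by rewrite mulr_ge0 ?powR_ge0 ?normc_ge0.
- by rewrite mulr_ge0.
- by apply: ler_pM => //; rewrite ?powR_ge0 ?normc_ge0.
Qed.

Lemma density_ge x xi u S : 0 <= u -> 0 <= S ->
  u <= normc (cexpi (dotv x xi) - 1) -> S <= psi xi `^ p ->
  (u * S) `^ alpha <= density x xi.
Proof.
move=> u0 S0 ux Sp; apply: (ge0_ler_powR (ltW alpha0)); rewrite ?nnegrE.
- by rewrite mulr_ge0.
- by rewrite mulr_ge0 ?powR_ge0 ?normc_ge0.
- exact: ler_pM.
Qed.

Lemma density_0 x : density x 0 = 0.
Proof.
have -> : density x 0 = (normc (cexpi 0 - 1) * psi 0 `^ p) `^ alpha.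
  by rewrite /density dotv0.
have -> : cexpi (0 : R) = 1 by apply/eqP; rewrite eq_complex/= cos0 sin0 !eqxx.
by rewrite subrr Normc.normc0 mul0r powR0// gt_eqF.
Qed.

Lemma measurable_psi : measurable_fun setT psi.
Proof. exact: continuous_measurable_cV. Qed.

Lemma cmeasurable_harmonizable_kernel x :
  cmeasurable (harmonizable_kernel E psi alpha H x).
Proof.
have mcos : measurable_fun setT (fun xi => cos (dotv x xi)).
  apply: (measurableT_comp (f := cos)); last exact: measurable_dotv.
  by apply: continuous_measurable_fun; exact: continuous_cos.
have msin : measurable_fun setT (fun xi => sin (dotv x xi)).
  apply: (measurableT_comp (f := sin)); last exact: measurable_dotv.
  by apply: continuous_measurable_fun; exact: continuous_sin.
have mpsi : measurable_fun setT (fun xi => psi xi `^ p).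
  exact: (measurableT_comp (measurable_powR p) measurable_psi).
split.
- rewrite (_ : (fun _ => _) = fun xi => (cos (dotv x xi) - 1) * psi xi `^ p).
    by apply: measurable_funM => //; exact: measurable_funB.
  by apply/funext => xi /=; rewrite mulr0 subr0.
- rewrite (_ : (fun _ => _) = fun xi => sin (dotv x xi) * psi xi `^ p).
    exact: measurable_funM.
  by apply/funext => xi /=; rewrite mulr0 add0r subr0.
Qed.

Lemma measurable_density x : measurable_fun setT (density x).
Proof.
have [mre mim] := cmeasurable_harmonizable_kernel x.
have -> : density x = fun xi =>
    Num.sqrt (complex.Re (harmonizable_kernel E psi alpha H x xi) ^+ 2 +
              complex.Im (harmonizable_kernel E psi alpha H x xi) ^+ 2) `^ alpha.
  by apply/funext => xi; rewrite -normc_harmonizable_kernel; case: harmonizable_kernel.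
have msqrt : measurable_fun setT (Num.sqrt : R -> R).
  by apply: continuous_measurable_fun; exact: sqrt_continuous.
have mnorm := measurable_funD (measurable_funX 2 mre) (measurable_funX 2 mim).
exact: (measurableT_comp (measurable_powR alpha) (measurableT_comp msqrt mnorm)).
Qed.

Lemma psi_expmx xi : xi != 0 -> psi (M^T *m xi) = expR 1 * psi xi.
Proof.
move=> xi0; rewrite -expmx_trmx -[in LHS](scale1r E^T) -[X in X *: _](@expRK R).
by rewrite -psi_homog ?expR_gt0.
Qed.

(** The substitution xi -> A^T xi changes the density by a constant factor and
moves [A] to the argument [x]. The relation is stable under products and inverses,
so it is computed for exp(E) alone. *)
Definition kernel_scaling (A : 'M[R]_n.+1) (c : R) :=
  forall x xi, density x (A^T *m xi) = c * density (A *m x) xi.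

Lemma kernel_scalingM A B a b : kernel_scaling A a -> kernel_scaling B b ->
  kernel_scaling (A *m B) (a * b).
Proof.
by move=> Aa Bb x xi; rewrite trmx_mul -(mulmxA B^T) Bb Aa mulmxA mulrCA mulrA.
Qed.

Lemma kernel_scalingX A a k : kernel_scaling A a -> kernel_scaling (A ^+ k) (a ^+ k).
Proof.
move=> Aa; elim: k => [|k IHk].
  by move=> x xi; rewrite !expr0 trmx1 !mul1mx mul1r.
by rewrite !exprS; exact: kernel_scalingM.
Qed.

Lemma kernel_scalingV A a : A \in unitmx -> a != 0 -> kernel_scaling A a ->
  kernel_scaling (invmx A) a^-1.
Proof.
move=> Au a0 Aa x xi; have := Aa (invmx A *m x) ((invmx A)^T *m xi).
have -> : A^T *m ((invmx A)^T *m xi) = xi.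
  by rewrite mulmxA -trmx_mul (mulVmx Au) trmx1 mul1mx.
by rewrite mulmxA (mulmxV Au) mul1mx => ->; rewrite (mulKf a0).
Qed.

(** Homogeneity turns psi^(- H - q / alpha) into e^(- H - q / alpha) times itself,
and the power [alpha] of that factor is e^(- alpha H - q). *)
Lemma kernel_scaling_expmx :
  kernel_scaling M (expR (- (alpha * H) - \tr E)).
Proof.
move=> x xi; have [->|xi0] := eqVneq xi 0; first by rewrite mulmx0 !density_0 mulr0.
rewrite /density dotv_mulmx psi_expmx// powRM ?expR_ge0// mulrCA powRM ?powR_ge0//.
  congr (_ * _); rewrite -powRrM /powR gt_eqF ?expR_gt0// expRK mulr1.
  by congr expR; rewrite /p; field; rewrite gt_eqF.
by rewrite mulr_ge0 ?powR_ge0 ?normc_ge0.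
Qed.

End kernel.

(* Conversion problems stay small as long as the powers in the density are folded. *)
#[global] Opaque density.

Section mass.
Variables (R : realType) (n : nat) (E : 'M[R]_n.+1) (psi : 'cV[R]_n.+1 -> R).
Variables (alpha H : R).
Hypotheses (psi_ge0 : forall x, 0 <= psi x) (psi_cont : continuous psi).
Hypothesis (psi_homog : mx_homogeneous E^T psi).
Hypothesis (alpha0 : 0 < alpha).
Local Notation normc := Normc.normc.
Local Notation leb := (lebesgue_cV R n.+1).
Local Notation M := (expmx E).
Local Notation dens := (density E psi alpha H).
Local Notation s := (expR (- (alpha * H))).

(** For [K] the whole space this is, up to the factor [c0], the alpha-th power of
the scale parameter of the field at [x]; localising it to [K] allows a
decomposition along the orbits of the powers of exp(E)^T. *)
Definition mass (K : set 'cV[R]_n.+1) (x : 'cV[R]_n.+1) : \bar R :=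
  (\int[leb]_xi ((\1_K xi : R) * dens x xi)%:E)%E.

Lemma mass_integrand_ge0 K x xi : (0 <= ((\1_K xi : R) * dens x xi)%:E)%E.
Proof. by rewrite lee_fin mulr_ge0 ?density_ge0. Qed.

Lemma mass_ge0 K x : (0 <= mass K x)%E.
Proof. by apply: integral_ge0 => xi _; exact: mass_integrand_ge0. Qed.

Lemma measurable_mass_integrand K x : measurable K ->
  measurable_fun setT (fun xi => ((\1_K xi : R) * dens x xi)%:E).
Proof.
move=> mK; apply/measurable_EFinP; apply: measurable_funM.
  exact: measurable_indic.
exact: measurable_density.
Qed.

Lemma mass_setT x :
  mass setT x = abs_power_integral alpha (harmonizable_kernel E psi alpha H x).
Proof.
apply: eq_integral => xi _.
by rewrite indicE in_setT mul1r normc_harmonizable_kernel.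
Qed.

Lemma measurable_preimage_mulmx (A : 'M[R]_n.+1) K : measurable K ->
  measurable ((fun xi : 'cV[R]_n.+1 => A *m xi) @^-1` K).
Proof.
by move=> mK; rewrite -[X in measurable X]setTI; exact: measurable_mulmx.
Qed.

(** The matrix [B] is passed separately from [A] to serve powers of exp(E) and of
its inverse alike. *)
Lemma mass_scaling (A B : 'M[R]_n.+1) (c : R) K x : A *m B = 1%:M ->
  0 <= c -> kernel_scaling E psi alpha H A c -> measurable K ->
  mass ((fun xi => B^T *m xi) @^-1` K) x =
  ((`|\det A| * c)%:E * mass K (A *m x))%E.
Proof.
move=> AB c0 Ac mK; rewrite /mass.
have dA : \det A^T != 0.
  rewrite det_tr; apply/eqP => A0; have := congr1 determinant AB.
  by rewrite det_mulmx A0 mul0r det1 => /eqP; rewrite eq_sym oner_eq0.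
rewrite -(ge0_integral_mulmx dA); last 2 first.
- by apply: measurable_mass_integrand; exact: measurable_preimage_mulmx.
- by move=> xi; exact: mass_integrand_ge0.
rewrite det_tr EFinM -muleA; congr (_ * _)%E.
rewrite -(ge0_integralZl_EFin _ measurableT
  (fun xi _ => mass_integrand_ge0 K (A *m x) xi)
  (measurable_mass_integrand (A *m x) mK) c0).
apply: eq_integral => xi _.
have -> : \1_((fun xi => B^T *m xi) @^-1` K) (A^T *m xi) = \1_K xi :> R.
  rewrite !indicE; congr (nat_of_bool _)%:R; apply/asboolP/asboolP;
    by rewrite /preimage/= mulmxA -trmx_mul AB trmx1 mul1mx.
by rewrite Ac -EFinM mulrCA.
Qed.

Lemma det_exprn (A : 'M[R]_n.+1) k : \det (A ^+ k) = \det A ^+ k.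
Proof. by elim: k => [|k IHk]; rewrite ?expr0 ?det1// !exprS -IHk -det_mulmx. Qed.

Lemma mulmx_exprnV (A : 'M[R]_n.+1) k : A \in unitmx ->
  A ^+ k *m invmx A ^+ k = 1%:M.
Proof.
move=> Au; elim: k => [|k IHk]; first by rewrite !expr0 mulmx1.
by rewrite exprSr exprS -mulmxE mulmxA -(mulmxA (A ^+ k)) mulmxV// mulmx1.
Qed.

Lemma mulVmx_exprn (A : 'M[R]_n.+1) k : A \in unitmx ->
  invmx A ^+ k *m A ^+ k = 1%:M.
Proof. by move=> Au; rewrite -{2}(invmxK A) mulmx_exprnV// unitmx_inv. Qed.

(** The factor e^(- alpha H - q) of the density meets the Jacobian e^q, so only
e^(- alpha H) is left: the trace in the exponent of psi is there to cancel the
Jacobian. *)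
Lemma mass_outer k K x : measurable K ->
  mass ((fun xi => (invmx M ^+ k)^T *m xi) @^-1` K) x =
  ((s ^+ k)%:E * mass K (M ^+ k *m x))%E.
Proof.
move=> mK; set c := expR (- (alpha * H) - \tr E).
have c0 : 0 <= c ^+ k by rewrite exprn_ge0// expR_ge0.
have Mc : kernel_scaling E psi alpha H (M ^+ k) (c ^+ k).
  by apply: kernel_scalingX; exact: kernel_scaling_expmx.
rewrite (mass_scaling x (mulmx_exprnV k (expmx_unitmx E)) c0 Mc mK).
congr (_%:E * _)%E; rewrite det_exprn normrX det_expmx -exprMn -expRD.
by congr (expR _ ^+ _); ring.
Qed.

Lemma mass_inner k K x : measurable K ->
  mass ((fun xi => (M ^+ k)^T *m xi) @^-1` K) x =
  ((expR (alpha * H) ^+ k)%:E * mass K (invmx M ^+ k *m x))%E.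
Proof.
move=> mK; set c := expR (- (alpha * H) - \tr E).
have cgt0 : 0 < c by exact: expR_gt0.
have c0 : 0 <= c^-1 ^+ k by rewrite exprn_ge0// invr_ge0 ltW.
have Mc : kernel_scaling E psi alpha H (invmx M ^+ k) (c^-1 ^+ k).
  apply: kernel_scalingX; apply: kernel_scalingV.
  - exact: expmx_unitmx.
  - by rewrite gt_eqF.
  - exact: kernel_scaling_expmx.
rewrite (mass_scaling x (mulVmx_exprn k (expmx_unitmx E)) c0 Mc mK).
congr (_%:E * _)%E; rewrite det_exprn det_inv normrX normfV det_expmx -exprMn.
by rewrite -!expRN -expRD; congr (expR _ ^+ _); ring.
Qed.

Lemma mass_expmx k x : mass setT x = ((s ^+ k)%:E * mass setT (M ^+ k *m x))%E.
Proof. by rewrite -mass_outer// preimage_setT. Qed.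

(** Operator self-similarity of the field, read off its scale parameters. *)
Lemma mass_invmx k x :
  mass setT x = ((expR (alpha * H) ^+ k)%:E * mass setT (invmx M ^+ k *m x))%E.
Proof. by rewrite -mass_inner// preimage_setT. Qed.

End mass.

(** * Finiteness and smallness of the control integral *)

Section geometric_bounds.
Variable R : realType.

Lemma nneseries_geometric_le (c r : R) : 0 <= c -> 0 <= r < 1 ->
  (\sum_(0 <= k <oo) (c * r ^+ k)%:E <= (c / (1 - r))%:E)%E.
Proof.
move=> c0 /andP[r0 r1]; apply: lime_le.
  by apply: is_cvg_nneseries => k _ _; rewrite lee_fin mulr_ge0 ?exprn_ge0.
near=> k; rewrite sumEFin lee_fin -mulr_sumr; apply: ler_wpM2l => //.
have r10 : 0 < 1 - r by rewrite subr_gt0.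
rewrite -[leRHS]mul1r ler_pdivlMr// big_mkord.
have := subrX1 r k; have := exprn_ge0 k r0; lra.
Unshelve. all: end_near. Qed.

Lemma exists_expr_lt (c r e : R) : 0 <= c -> 0 <= r < 1 -> 0 < e ->
  exists k, c * r ^+ k < e.
Proof.
move=> c0 /andP[r0 r1] e0.
have : `|r| < 1 by rewrite ger0_norm.
move=> /cvg_expr/cvgr0Pnorm_lt/(_ (e / (c + 1))).
rewrite divr_gt0 ?ltr_wpDl// => /(_ isT)[k _ /(_ k (leqnn k))].
rewrite /= ger0_norm ?exprn_ge0// ltr_pdivlMr ?ltr_wpDl// => ke.
exists k; apply: le_lt_trans ke; rewrite mulrC ler_wpM2l ?exprn_ge0//.
by rewrite lerDl.
Qed.

Lemma powR_exprn (x a : R) k : 0 <= x -> (x ^+ k) `^ a = (x `^ a) ^+ k.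
Proof.
move=> x0; rewrite -powR_mulrn// -powRrM mulrC powRrM powR_mulrn//.
exact: powR_ge0.
Qed.

Lemma powR_expR (x a : R) : expR x `^ a = expR (a * x).
Proof. by rewrite /powR gt_eqF ?expR_gt0// expRK. Qed.

End geometric_bounds.

Section existence.
Variables (R : realType) (n : nat) (E : 'M[R]_n.+1) (psi : 'cV[R]_n.+1 -> R).
Variables (alpha H : R).
Hypotheses (psi_ge0 : forall x, 0 <= psi x) (psi_cont : continuous psi).
Hypothesis (psi_homog : mx_homogeneous E^T psi).
Hypothesis (psi_neq0 : forall x, x != 0 -> psi x != 0).
Hypothesis (alpha0 : 0 < alpha).
Local Notation normc := Normc.normc.
Local Notation leb := (lebesgue_cV R n.+1).
Local Notation M := (expmx E).
Local Notation dens := (density E psi alpha H).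
Local Notation mass := (mass E psi alpha H).

Variables (C b : R).
Hypothesis invM_decay : forall k, `|invmx M ^+ k| <= C * expR (- b) ^+ k.
Hypotheses (H0 : 0 < H) (Hb : H < b).

Let r := expR (- b).

Let r01 : 0 <= r < 1.
Proof. by rewrite expR_ge0/= expR_lt1 oppr_lt0 (lt_trans H0). Qed.

Let C0 : 0 <= C.
Proof. by have := le_trans (normr_ge0 _) (invM_decay 0); rewrite expr0 mulr1. Qed.

Lemma norm_trmx (A : 'M[R]_n.+1) : `|A^T| <= `|A|.
Proof. by apply: ler_mx_norm => // i j; rewrite mxE ler_mx_entry. Qed.

(** A compact fundamental domain, up to overlaps, for the powers of exp(E)^T
acting on nonzero vectors. Since that matrix need not increase the norm at every
step, the shell is cut out by the norms of a point and of its image. *)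
Definition shell : set 'cV[R]_n.+1 :=
  [set xi | `|xi| <= 1 /\ 1 <= `|M^T *m xi|].

Lemma shell_neq0 xi : shell xi -> xi != 0.
Proof.
by move=> [_]; apply: contraTneq => ->; rewrite mulmx0 normr0 ler10.
Qed.

Lemma closed_shell : closed shell.
Proof.
apply: closedI.
  apply: (@closed_comp _ _ (fun xi : 'cV[R]_n.+1 => `|xi|) [set t | t <= 1]).
    by move=> xi _; exact: norm_continuous.
  exact: closed_le.
apply: (@closed_comp _ _ (fun xi : 'cV[R]_n.+1 => `|M^T *m xi|) [set t | 1 <= t]).
  move=> xi _; apply: (continuous_comp (f := fun xi : 'cV[R]_n.+1 => M^T *m xi)
    (g := fun v : 'cV[R]_n.+1 => `|v|)); first exact: continuous_mulmx.
  exact: norm_continuous.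
exact: closed_ge.
Qed.

Lemma measurable_shell : measurable shell.
Proof.
rewrite -(setCK shell); apply: measurableC; apply: open_measurable_cV.
exact/closed_openC/closed_shell.
Qed.

Lemma compact_shell : compact shell.
Proof.
apply: bounded_closed_compact_cV; last exact: closed_shell.
by exists 1; split=> // t t1 xi [xi1 _]; exact: (le_trans xi1 (ltW t1)).
Qed.

(** An orbit tends to 0 in one direction and to infinity in the other, so it
crosses the unit sphere; the first crossing lies in the shell. *)
Lemma shell_cover xi : xi != 0 ->
  exists k, shell ((M ^+ k)^T *m xi) \/ shell ((invmx M ^+ k.+1)^T *m xi).
Proof.
move=> xi0; have xigt0 : 0 < `|xi| by rewrite normr_gt0.
have Mu := expmx_unitmx E.
have small k (v : 'cV[R]_n.+1) : `|(invmx M ^+ k)^T *m v| <= n.+1%:R * C * `|v| * r ^+ k.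
  apply: (le_trans (ler_normM_mulmx _ _)).
  have -> : n.+1%:R * C * `|v| * r ^+ k = n.+1%:R * (C * r ^+ k) * `|v| by ring.
  apply: ler_wpM2r => //; apply: ler_wpM2l => //.
  exact: (le_trans (norm_trmx _) (invM_decay k)).
have large k : `|xi| <= n.+1%:R * C * `|(M ^+ k)^T *m xi| * r ^+ k.
  by have := small k ((M ^+ k)^T *m xi);
    rewrite mulmxA -trmx_mul mulmx_exprnV// trmx1 mul1mx.
have nC0 : 0 <= n.+1%:R * C by rewrite mulr_ge0.
(* Inside the unit ball iterate M^T until the norm exceeds 1, outside iterate its
   inverse until the norm drops to 1. *)
have [xi1|xi1] := leP `|xi| 1.
  have exk : exists k, 1 < `|(M ^+ k)^T *m xi|.
    have [k hk] := exists_expr_lt nC0 r01 xigt0.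
    exists k; rewrite ltNge; apply/negP => h.
    have := lt_le_trans hk (large k); rewrite ltNge => /negP; apply.
    rewrite mulrAC -[leRHS]mulr1; apply: ler_wpM2l => //.
    by rewrite mulr_ge0// exprn_ge0//; case/andP: r01.
  case: (ex_minnP exk) => -[|k] hk kmin.
    by move: hk; rewrite expr0 trmx1 mul1mx ltNge xi1.
  exists k; left; split.
    by rewrite leNgt; apply/negP => /kmin; rewrite ltnn.
  by rewrite mulmxA -trmx_mul mulmxE -exprSr ltW.
have exk : exists k, `|(invmx M ^+ k)^T *m xi| <= 1.
  have nCx0 : 0 <= n.+1%:R * C * `|xi| by rewrite mulr_ge0.
  have [k hk] := exists_expr_lt nCx0 r01 ltr01.
  by exists k; exact: (le_trans (small k xi) (ltW hk)).
case: (ex_minnP exk) => -[|k] hk kmin.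
  by move: hk; rewrite expr0 trmx1 mul1mx leNgt xi1.
exists k; right; split=> //.
rewrite mulmxA -trmx_mul exprSr -mulmxE -mulmxA mulVmx// mulmx1.
by rewrite leNgt; apply/negP => /ltW/kmin; rewrite ltnn.
Qed.

Lemma psi_powR_shell_bounded q :
  exists2 S : R, 0 <= S & forall xi, shell xi -> psi xi `^ q <= S.
Proof.
have [sh0|/set0P/negP/negPn/eqP sh0] := pselect (shell !=set0); last first.
  by exists 0 => // xi; rewrite sh0.
have cpsi : {within shell, continuous psi} by exact: continuous_subspaceT.
have [u ush uP] := compact_EVT_min sh0 compact_shell cpsi.
have [w wsh wP] := compact_EVT_max sh0 compact_shell cpsi.
have psi_gt0 xi : shell xi -> 0 < psi xi.
  by move=> /shell_neq0 /psi_neq0 ?; rewrite lt_neqAle eq_sym psi_ge0 andbT.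
have [q0|q0] := leP 0 q.
  exists (psi w `^ q); first exact: powR_ge0.
  by move=> xi xish; rewrite ge0_ler_powR ?nnegrE// wP// inE.
exists ((psi u `^ (- q))^-1); first by rewrite invr_ge0 powR_ge0.
move=> xi xish; have -> : psi xi `^ q = (psi xi `^ (- q))^-1 by rewrite powRN invrK.
have upos : 0 < psi u by apply: psi_gt0; rewrite inE in ush.
have xipos := psi_gt0 _ xish; rewrite lef_pV2 ?posrE ?powR_gt0//.
by rewrite ge0_ler_powR ?nnegrE ?oppr_ge0 ?(ltW q0)// uP// inE.
Qed.

Let V : R := 4 ^+ n.+1.

Lemma mass_shell_le x c : 0 <= c -> (forall xi, shell xi -> dens x xi <= c) ->
  (mass shell x <= (c * V)%:E)%E.
Proof.
move=> c0 hc; pose Q : set 'cV[R]_n.+1 := cube 0 2.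
have m1 : measurable_fun setT (fun xi => (\1_Q xi : R)%:E).
  by apply/measurable_EFinP; apply: measurable_indic; exact: measurable_cube.
have -> : ((c * V)%:E = \int[leb]_xi (c%:E * (\1_Q xi)%:E))%E.
  rewrite (ge0_integralZl_EFin _ measurableT _ m1 c0)//.
  rewrite integral_indic//; last exact: measurable_cube.
  by rewrite setIT /Q/= (@lebesgue_cube R n.+1 0 2)// EFinM /V; congr (_ * (_ ^+ _)%:E)%E; ring.
apply: ge0_le_integral => //.
- by move=> xi _; exact: mass_integrand_ge0.
- exact: (measurable_mass_integrand _ _ _ psi_cont x measurable_shell).
- exact: measurable_funeM.
move=> xi _; rewrite -EFinM lee_fin.
rewrite [\1_shell xi]indicE; have [|_] := boolP (xi \in shell); last first.
  by rewrite mul0r mulr_ge0.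
rewrite inE => xish; rewrite mul1r indicE mem_set ?mulr1; first exact: hc.
apply/cubeP => //; rewrite sub0r normrN.
by apply: le_lt_trans xish.1 _; rewrite ltr1n.
Qed.

Lemma mass_le_shells x : (mass setT x <=
  \sum_(0 <= k <oo) mass ((fun xi => (M ^+ k)^T *m xi) @^-1` shell) x +
  \sum_(0 <= k <oo) mass ((fun xi => (invmx M ^+ k.+1)^T *m xi) @^-1` shell) x)%E.
Proof.
have msh := measurable_shell.
pose f k xi := ((\1_((fun xi => (M ^+ k)^T *m xi) @^-1` shell) xi : R) * dens x xi)%:E.
pose g k xi :=
  ((\1_((fun xi => (invmx M ^+ k.+1)^T *m xi) @^-1` shell) xi : R) * dens x xi)%:E.
have mf k : measurable_fun setT (f k).
  by apply: measurable_mass_integrand => //; exact: measurable_preimage_mulmx.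
have mg k : measurable_fun setT (g k).
  by apply: measurable_mass_integrand => //; exact: measurable_preimage_mulmx.
have f0 k xi : (0 <= f k xi)%E by exact: mass_integrand_ge0.
have g0 k xi : (0 <= g k xi)%E by exact: mass_integrand_ge0.
have mlim (h : nat -> 'cV[R]_n.+1 -> \bar R) : (forall k, measurable_fun setT (h k)) ->
    (forall k xi, (0 <= h k xi)%E) ->
    measurable_fun setT (fun xi => (\sum_(0 <= k <oo) h k xi)%E).
  move=> mh h0; by apply: ge0_emeasurable_sum.
pose F xi := (\sum_(0 <= k <oo) f k xi)%E.
pose G xi := (\sum_(0 <= k <oo) g k xi)%E.
have F0 xi : (0 <= F xi)%E by apply: nneseries_ge0 => k _ _; exact: f0.
have G0 xi : (0 <= G xi)%E by apply: nneseries_ge0 => k _ _; exact: g0.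
have mF : measurable_fun setT F by exact: mlim.
have mG : measurable_fun setT G by exact: mlim.
rewrite -[X in (_ <= X + _)%E](integral_nneseries _ measurableT mf (fun k xi _ => f0 k xi)).
rewrite -[X in (_ <= _ + X)%E](integral_nneseries _ measurableT mg (fun k xi _ => g0 k xi)).
rewrite -(ge0_integralD _ measurableT (fun xi _ => F0 xi) mF (fun xi _ => G0 xi) mG).
apply: (ge0_le_integral _ measurableT).
- by move=> xi _; exact: mass_integrand_ge0.
- exact: (measurable_mass_integrand _ _ _ psi_cont x measurableT).
- exact: (emeasurable_funD mF mG).
move=> xi _; rewrite indicE in_setT mul1r.
have [->|xi0] := eqVneq xi 0; first by rewrite density_0// adde_ge0.
have ler_term (h : nat -> \bar R) k : (forall k, (0 <= h k)%E) ->
    (h k <= \sum_(0 <= i <oo) h i)%E.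
  move=> h0; apply: le_trans (nneseries_lim_ge k.+1 (fun i _ _ => h0 i)).
  by rewrite big_nat_recr//= leeDr// sume_ge0.
have [k [shk|shk]] := shell_cover xi0.
- apply: (@le_trans _ _ (F xi)); last by rewrite leeDl.
  apply: le_trans (ler_term (f^~ xi) k (fun k => f0 k xi)).
  by rewrite /f indicE mem_set// mul1r.
- apply: (@le_trans _ _ (G xi)); last by rewrite leeDr.
  apply: le_trans (ler_term (g^~ xi) k (fun k => g0 k xi)).
  by rewrite /g indicE mem_set// mul1r.
Qed.

(** Summing over the images of the shell. Near the origin the density is estimated
linearly in <M^-k x, xi>, and the decay e^(- b k) beats the factor e^(alpha H k)
because H < b; far away the bound 2 on |e^(i u) - 1| suffices because H > 0. *)
Lemma mass_setT_bound : exists A1 A2 : R, [/\ 0 <= A1, 0 <= A2 &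
  forall x, (mass setT x <= (A1 * `|x| `^ alpha + A2)%:E)%E].
Proof.
have [S S0 hS] := psi_powR_shell_bounded (- H - \tr E / alpha).
have V0 : 0 <= V by rewrite exprn_ge0.
have msh := measurable_shell.
have /andP[r0 r1] := r01.
pose rho := expR (alpha * (H - b)).
have rho01 : 0 <= rho < 1.
  by rewrite expR_ge0/= expR_lt1 pmulr_rlt0// subr_lt0.
pose s := expR (- (alpha * H)).
have s01 : 0 <= s < 1 by rewrite expR_ge0/= expR_lt1 oppr_lt0 mulr_gt0.
pose c1 := (n.+1%:R * (n.+1%:R * C) * S) `^ alpha * V.
pose c2 := (2 * S) `^ alpha * V.
have c10 : 0 <= c1 by rewrite mulr_ge0// powR_ge0.
have c20 : 0 <= c2 by rewrite mulr_ge0// powR_ge0.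
exists (c1 / (1 - rho)), (c2 / (1 - s)); split.
- by rewrite divr_ge0// subr_ge0 ltW//; case/andP: rho01.
- by rewrite divr_ge0// subr_ge0 ltW//; case/andP: s01.
move=> x; apply: (le_trans (mass_le_shells x)); rewrite EFinD; apply: leeD.
- rewrite mulrAC; apply: le_trans (nneseries_geometric_le _ rho01); last first.
    by rewrite mulr_ge0// powR_ge0.
  apply: lee_nneseries => [k _ _|k _]; first exact: mass_ge0.
  rewrite mass_inner//.
  pose D := n.+1%:R * (n.+1%:R * C) * `|x| * S.
  have D0 : 0 <= D by rewrite /D !mulr_ge0.
  have hk : (mass shell (invmx M ^+ k *m x) <= ((D * r ^+ k) `^ alpha * V)%:E)%E.
    apply: mass_shell_le => [|xi xish]; first exact: powR_ge0.
    have -> : D * r ^+ k = n.+1%:R * (n.+1%:R * (C * r ^+ k) * `|x|) * S.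
      by rewrite /D; ring.
    apply: density_le => //; last exact: hS.
    apply: (le_trans (normc_cexpiB1_le _)); apply: (le_trans (dotv_le _ _)).
    rewrite -[leRHS]mulr1; apply: ler_pM => //; last exact: xish.1.
    apply: ler_wpM2l => //; apply: (le_trans (ler_normM_mulmx _ _)).
    by apply: ler_wpM2r => //; apply: ler_wpM2l => //; exact: invM_decay.
  apply: (le_trans (lee_wpmul2l _ hk)); first by rewrite lee_fin exprn_ge0// expR_ge0.
  rewrite -EFinM lee_fin powRM ?exprn_ge0// powR_exprn// powR_expR.
  rewrite /D [n.+1%:R * _ * _ * S]mulrAC powRM ?mulr_ge0//.
  rewrite le_eqVlt; apply/orP; left; apply/eqP.
  have -> : rho ^+ k = expR (alpha * H) ^+ k * expR (alpha * - b) ^+ k.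
    by rewrite -exprMn -expRD /rho mulrBr mulrN.
  by rewrite /c1; ring.
- apply: le_trans (nneseries_geometric_le c20 s01).
  apply: lee_nneseries => [k _ _|k _]; first exact: mass_ge0.
  rewrite mass_outer//.
  have hk : (mass shell (M ^+ k.+1 *m x) <= c2%:E)%E.
    apply: mass_shell_le => [|xi xish]; first exact: powR_ge0.
    by apply: density_le => //; [exact: normc_cexpiB1_le2|exact: hS].
  apply: (le_trans (lee_wpmul2l _ hk)); first by rewrite lee_fin exprn_ge0// expR_ge0.
  rewrite -EFinM lee_fin mulrC; apply: ler_wpM2l => //.
  have /andP[s0 s1] := s01.
  by rewrite exprS -[leRHS]mul1r; apply: ler_wpM2r; [rewrite exprn_ge0|exact: ltW].
Qed.

Lemma mass_setT_lty x : (mass setT x < +oo)%E.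
Proof.
have [A1 [A2 [_ _ hA]]] := mass_setT_bound.
by apply: le_lt_trans (hA x) _; rewrite ltry.
Qed.

(** By [mass_setT_bound] the mass is bounded on the unit ball; scaling turns this
into a small multiple e^(- alpha H k) of the same bound on a smaller ball. *)
Lemma mass_setT_small e : 0 < e ->
  exists2 d, 0 < d & forall x, `|x| <= d -> (mass setT x <= e%:E)%E.
Proof.
move=> e0; have [A1 [A2 [A10 A20 hA]]] := mass_setT_bound.
have s01 : 0 <= expR (- (alpha * H)) < 1.
  by rewrite expR_ge0/= expR_lt1 oppr_lt0 mulr_gt0.
have [|k hk] := exists_expr_lt _ s01 e0 (c := A1 + A2); first exact: addr_ge0.
pose D := n.+1%:R * `|M ^+ k| + 1.
have D0 : 0 < D by rewrite ltr_wpDl// mulr_ge0.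
exists D^-1 => [|x xD]; first by rewrite invr_gt0.
have Mx1 : `|M ^+ k *m x| <= 1.
  apply: (le_trans (ler_normM_mulmx _ _)); apply: (@le_trans _ _ (D * `|x|)).
    by apply: ler_wpM2r => //; rewrite lerDl.
  by rewrite -ler_pdivlMl// mulr1.
rewrite (mass_expmx H psi_ge0 psi_cont psi_homog alpha0 k).
have hx : (mass setT (M ^+ k *m x) <= (A1 + A2)%:E)%E.
  apply: (le_trans (hA _)); rewrite lee_fin lerD2r -[leRHS]mulr1.
  have p1 : 1 `^ alpha = 1 :> R by rewrite powR1.
  apply: ler_wpM2l => //; rewrite -[leRHS]p1.
  by rewrite ge0_ler_powR ?nnegrE// ltW.
apply: (le_trans (lee_wpmul2l _ hx)).
  by rewrite lee_fin exprn_ge0//; case/andP: s01.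
by rewrite -EFinM lee_fin mulrC ltW.
Qed.

End existence.

(** * Lower bounds for the control integral *)

Section complex_pairing.
Variables (R : realType) (n : nat).
Implicit Types (v : 'cV[R[i]]_n) (xi : 'cV[R]_n).
Local Notation normc := Normc.normc.

Definition Rev v : 'cV[R]_n := map_mx (@complex.Re R) v.
Definition Imv v : 'cV[R]_n := map_mx (@complex.Im R) v.
(** Bilinear extension of the inner product, with a complex first argument. *)
Definition cdot v xi : R[i] := (dotv (Rev v) xi +i* dotv (Imv v) xi)%C.

Lemma Re_sum (F : 'I_n -> R[i]) :
  complex.Re (\sum_i F i) = \sum_i complex.Re (F i).
Proof.
by apply: (big_morph (@complex.Re R) (id1 := 0) (op1 := +%R)) => // -[a b] [c d].
Qed.

Lemma Im_sum (F : 'I_n -> R[i]) :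
  complex.Im (\sum_i F i) = \sum_i complex.Im (F i).
Proof.
by apply: (big_morph (@complex.Im R) (id1 := 0) (op1 := +%R)) => // -[a b] [c d].
Qed.

Lemma cdotE v xi : cdot v xi = \sum_i v i ord0 * (xi i ord0)%:C%C.
Proof.
have sumC (F G : 'I_n -> R) :
    ((\sum_i F i) +i* (\sum_i G i))%C = \sum_i (F i +i* G i)%C.
  by apply/eqP; rewrite eq_complex Re_sum Im_sum/= !eqxx.
rewrite /cdot /dotv sumC; apply: eq_bigr => i _; rewrite !mxE.
by case: (v i ord0) => a b; simpc.
Qed.

Lemma cdotZ c v xi : cdot (c *: v) xi = c * cdot v xi.
Proof. by rewrite !cdotE mulr_sumr; apply: eq_bigr => i _; rewrite mxE mulrA. Qed.

Lemma cdot_mulmx (A : 'M[R]_n) v xi :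
  cdot (mxC A *m v) xi = (dotv (A *m Rev v) xi +i* dotv (A *m Imv v) xi)%C.
Proof.
have -> : A *m Rev v = Rev (mxC A *m v).
  apply/colP => i; rewrite !mxE Re_sum; apply: eq_bigr => j _; rewrite !mxE.
  by case: (v j ord0) => a b; simpc.
have -> : A *m Imv v = Imv (mxC A *m v).
  apply/colP => i; rewrite !mxE Im_sum; apply: eq_bigr => j _; rewrite !mxE.
  by case: (v j ord0) => a b; simpc.
by [].
Qed.

Lemma normc_le_sum (a b : R) : normc (a +i* b)%C <= `|a| + `|b|.
Proof.
rewrite -(@ler_pXn2r _ 2)// ?nnegrE ?sqrtr_ge0 ?addr_ge0//.
rewrite /= sqr_sqrtr ?addr_ge0 ?sqr_ge0//.
rewrite -(real_normK (num_real a)) -(real_normK (num_real b)).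
by have := normr_ge0 a; have := normr_ge0 b; nra.
Qed.

Lemma normr_Re_le (a b : R) : `|a| <= normc (a +i* b)%C.
Proof.
rewrite -(@ler_pXn2r _ 2)// ?nnegrE ?sqrtr_ge0//.
by rewrite /= sqr_sqrtr ?addr_ge0 ?sqr_ge0// real_normK ?num_real// lerDl sqr_ge0.
Qed.

Lemma normr_Im_le (a b : R) : `|b| <= normc (a +i* b)%C.
Proof.
rewrite -(@ler_pXn2r _ 2)// ?nnegrE ?sqrtr_ge0//.
by rewrite /= sqr_sqrtr ?addr_ge0 ?sqr_ge0// real_normK ?num_real// lerDr sqr_ge0.
Qed.

End complex_pairing.

Section lower_bounds.
Variables (R : realType) (n : nat) (E : 'M[R]_n.+1) (psi : 'cV[R]_n.+1 -> R).
Variables (alpha H : R).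
Hypotheses (psi_ge0 : forall x, 0 <= psi x) (psi_cont : continuous psi).
Hypothesis (psi_homog : mx_homogeneous E^T psi).
Hypothesis (psi_neq0 : forall x, x != 0 -> psi x != 0).
Hypothesis (alpha0 : 0 < alpha).
Local Notation normc := Normc.normc.
Local Notation leb := (lebesgue_cV R n.+1).
Local Notation M := (expmx E).
Local Notation dens := (density E psi alpha H).
Local Notation mass := (mass E psi alpha H).

(** A cube on which <v, xi> is bounded away from 0 and from above, and on which
psi varies by less than the factor e by which exp(E)^T multiplies it. *)
Lemma exists_window (v : 'cV[R[i]]_n.+1) (q : R) : v != 0 ->
  exists (z : 'cV[R]_n.+1) (e l kappa : R), [/\ 0 < e, 0 < kappa &
    forall xi, cube z e xi -> [/\ 1 / 4 <= normc (cdot v xi) <= 1,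
      l * expR (- (1 / 2)) < psi xi < l * expR (1 / 2) & kappa <= psi xi `^ q]].
Proof.
move=> v0; pose g xi := normc (cdot v xi).
have [z z0] : exists z, 0 < g z.
  have [x0|x0] := eqVneq (Rev v) 0; last first.
    exists (Rev v); rewrite /g; apply: lt_le_trans (normr_Re_le _ _).
    by rewrite normr_gt0 gt_eqF// dotvv_gt0.
  have [y0|y0] := eqVneq (Imv v) 0; last first.
    exists (Imv v); rewrite /g; apply: lt_le_trans (normr_Im_le _ _).
    by rewrite normr_gt0 gt_eqF// dotvv_gt0.
  case/eqP: v0; apply/colP => i.
  move/colP/(_ i): x0; move/colP/(_ i): y0; rewrite !mxE.
  by case: (v i ord0) => a b /= -> ->.
have gZ c xi : 0 <= c -> g (c *: xi) = c * g xi.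
  move=> c0; rewrite /g (_ : cdot v (c *: xi) = c%:C%C * cdot v xi).
    by rewrite Normc.normcM normc_real ger0_norm.
  by rewrite !cdotE mulr_sumr; apply: eq_bigr => i _; rewrite mxE rmorphM mulrCA.
have cg : continuous g.
  move=> xi; apply: (continuous_comp (g := Num.sqrt)
    (f := fun xi => dotv (Rev v) xi * dotv (Rev v) xi + dotv (Imv v) xi * dotv (Imv v) xi));
    last exact: sqrt_continuous.
  have c1 := @continuous_dotv R n.+1 (Rev v) xi.
  have c2 := @continuous_dotv R n.+1 (Imv v) xi.
  exact: (cvgD (cvgM c1 c1) (cvgM c2 c2)).
(* Normalised so that |<v, xi0>| = 1 / 2, midway inside the window. *)
pose xi0 := (2 * g z)^-1 *: z.
have gxi0 : g xi0 = 1 / 2.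
  by rewrite gZ ?invr_ge0 ?mulr_ge0 ?ltW//; field; rewrite gt_eqF.
have xi00 : xi0 != 0.
  apply: contra_eqN gxi0 => /eqP ->; rewrite -(scale0r 0) gZ// mul0r eq_sym.
  by rewrite mul1r invr_eq0 pnatr_eq0.
pose l := psi xi0.
have l0 : 0 < l by rewrite lt_neqAle eq_sym psi_ge0 psi_neq0.
have e1 : expR (- (1 / 2)) < 1 :> R by rewrite expR_lt1; lra.
have e2 : 1 < expR (1 / 2) :> R by rewrite expR_gt1; lra.
have near_xi0 : \forall xi \near xi0,
    [/\ 1 / 4 < g xi, g xi < 1, l * expR (- (1 / 2)) < psi xi & psi xi < l * expR (1 / 2)].
  near=> xi; split; near: xi.
  - by apply: (cvgr_gt _ (cg xi0)); rewrite gxi0; lra.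
  - by apply: (cvgr_lt _ (cg xi0)); rewrite gxi0; lra.
  - apply: (cvgr_gt _ (@psi_cont xi0)).
    by rewrite -/l -[ltRHS]mulr1 ltr_pM2l.
  - apply: (cvgr_lt _ (@psi_cont xi0)).
    by rewrite -/l -[ltLHS]mulr1 ltr_pM2l.
have /nbhs_ballP[e /= e0 he] := near_xi0.
(* The exponent q may have either sign, so psi^q is bounded below by its value at
   one of the two ends. *)
pose kappa := Num.min ((l * expR (- (1 / 2))) `^ q) ((l * expR (1 / 2)) `^ q).
exists xi0, e, l, kappa; split => //.
  by rewrite lt_min; apply/andP; split; apply: powR_gt0; rewrite mulr_gt0 ?expR_gt0.
move=> xi /cubeP-/(_ e0) xie.
have [g1 g2 p1 p2] : [/\ 1 / 4 < g xi, g xi < 1,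
    l * expR (- (1 / 2)) < psi xi & psi xi < l * expR (1 / 2)].
  by apply: he; rewrite -ball_normE.
split; [by rewrite !ltW|by rewrite p1 p2|].
rewrite ge_min.
have le1 : 0 < l * expR (- (1 / 2)) by rewrite mulr_gt0 ?expR_gt0.
have le2 : 0 < l * expR (1 / 2) by rewrite mulr_gt0 ?expR_gt0.
have psi0 : 0 < psi xi := lt_trans le1 p1.
have [q0|q0] := leP 0 q.
  apply/orP; left; apply: (ge0_ler_powR q0); rewrite ?nnegrE; exact: ltW.
apply/orP; right.
have powV (t : R) : t `^ q = (t `^ (- q))^-1 by rewrite powRN invrK.
rewrite (powV (psi xi)) (powV (l * _)) lef_pV2 ?posrE ?powR_gt0//.
have Nq0 : 0 <= - q by rewrite oppr_ge0 ltW.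
by apply: (ge0_ler_powR Nq0); rewrite ?nnegrE; exact: ltW.
Unshelve. all: end_near. Qed.

Lemma mass_add_ge (z : 'cV[R]_n.+1) e c x y : 0 < e -> 0 <= c ->
  (forall xi, cube z e xi -> c <= dens x xi + dens y xi) ->
  ((c * (e *+ 2) ^+ n.+1)%:E <= mass (cube z e) x + mass (cube z e) y)%E.
Proof.
move=> e0 c0 hc; pose Q := cube z e.
have mQ : measurable Q by exact: measurable_cube.
have m1 : measurable_fun setT (fun xi => (\1_Q xi : R)%:E).
  by apply/measurable_EFinP; exact: measurable_indic.
have -> : ((c * (e *+ 2) ^+ n.+1)%:E = \int[leb]_xi (c%:E * (\1_Q xi)%:E))%E.
  rewrite (ge0_integralZl_EFin _ measurableT _ m1 c0)//.
  by rewrite integral_indic// setIT /Q/= lebesgue_cube// EFinM.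
have mx := measurable_mass_integrand E alpha H psi_cont x mQ.
have my := measurable_mass_integrand E alpha H psi_cont y mQ.
have p0 x' xi := mass_integrand_ge0 E psi alpha H Q x' xi.
rewrite /mass -(ge0_integralD _ measurableT (fun xi _ => p0 x xi) mx (fun xi _ => p0 y xi) my).
apply: (ge0_le_integral _ measurableT).
- by move=> xi _; rewrite lee_fin mulr_ge0.
- exact: measurable_funeM.
- exact: (emeasurable_funD mx my).
move=> xi _; rewrite -EFinM -EFinD lee_fin indicE.
have [|_] := boolP (xi \in Q); last by rewrite !mul0r mulr0 addr0.
by rewrite inE => /hc; rewrite !mul1r mulr1.
Qed.

Lemma mass_le_setT K x : measurable K -> (mass K x <= mass setT x)%E.
Proof.
move=> mK; apply: (ge0_le_integral _ measurableT).
- by move=> xi _; exact: mass_integrand_ge0.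
- exact: measurable_mass_integrand.
- exact: measurable_mass_integrand.
move=> xi _; rewrite lee_fin indicT; apply: ler_wpM2r; first exact: density_ge0.
by rewrite indicE lern1 leq_b1.
Qed.

Lemma mass_setT_gt0 x : x != 0 -> (0 < mass setT x)%E.
Proof.
move=> x0; pose v : 'cV[R[i]]_n.+1 := mxC x.
have [|z [e [l [kappa [e0 k0 hz]]]]] := @exists_window v (- H - \tr E / alpha).
  apply: contra_neq x0 => v0; apply/colP => i.
  by move/colP/(_ i): v0; rewrite !mxE => -[].
have Rv : Rev v = x by apply/colP => i; rewrite !mxE.
have Iv : Imv v = 0 by apply/colP => i; rewrite !mxE.
pose c := (1 / 8 * kappa) `^ alpha.
have c0 : 0 < c by apply: powR_gt0; rewrite mulr_gt0//; lra.
have hc xi : cube z e xi -> c <= dens x xi + dens x xi.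
  move=> /hz[/andP[g1 g2] _ kp].
  have xg : normc (cdot v xi) = `|dotv x xi|.
    rewrite /cdot Rv Iv /dotv [X in (_ +i* X)%C]big1 ?normc_real// => i _.
    by rewrite mxE mul0r.
  have dx : c <= dens x xi.
    have u0 : 0 <= 1 / 8 :> R by lra.
    have ux : 1 / 8 <= normc (cexpi (dotv x xi) - 1).
      by apply: le_trans (normc_cexpiB1_ge _); rewrite -xg//; lra.
    exact: (density_ge alpha0 u0 (ltW k0) ux kp).
  by apply: (le_trans dx); rewrite lerDl density_ge0.
have h := mass_add_ge e0 (ltW c0) hc; rewrite lt_neqAle mass_ge0 andbT; apply/eqP => m0.
have := le_trans h (leeD (mass_le_setT x (measurable_cube z e)) (mass_le_setT x (measurable_cube z e))).
rewrite -m0 adde0 lee_fin leNgt => /negP; apply.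
by rewrite mulr_gt0// exprn_gt0// pmulrn_lgt0.
Qed.

Lemma psi_expmxX k xi : xi != 0 -> psi ((M ^+ k)^T *m xi) = expR 1 ^+ k * psi xi.
Proof.
move=> xi0; elim: k => [|k IHk]; first by rewrite !expr0 trmx1 !mul1mx mul1r.
rewrite exprSr -mulmxE trmx_mul -mulmxA psi_expmx//.
  by rewrite IHk mulrA -exprS.
apply: contra_neq xi0 => Mxi0.
have := congr1 (mulmx (invmx M ^+ k)^T) Mxi0.
by rewrite mulmxA -trmx_mul mulmx_exprnV ?expmx_unitmx// trmx1 mul1mx mulmx0.
Qed.

(** The preimages of [B] are disjoint because psi takes values in the disjoint
intervals e^(- k) (l e^(- 1/2), l e^(1/2)) on them. *)
Lemma mass_disjoint_shells (B : set 'cV[R]_n.+1) l m x : measurable B ->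
  ~ B 0 -> (forall xi, B xi -> l * expR (- (1 / 2)) < psi xi < l * expR (1 / 2)) ->
  (\sum_(k < m) mass ((fun xi => (M ^+ k)^T *m xi) @^-1` B) x <= mass setT x)%E.
Proof.
move=> mB B0 Bpsi.
have mBk k : measurable ((fun xi => (M ^+ k)^T *m xi) @^-1` B).
  exact: measurable_preimage_mulmx.
have disj (i j : nat) xi : B ((M ^+ i)^T *m xi) -> B ((M ^+ j)^T *m xi) -> (i <= j)%N -> i = j.
  move=> Bi Bj; rewrite leq_eqVlt => /predU1P[//|ij].
  have xi0 : xi != 0 by apply: contra_notN B0 => /eqP xi0; move: Bi; rewrite xi0 mulmx0.
  have /andP[li _] := Bpsi _ Bi; have /andP[_ lj] := Bpsi _ Bj.
  move: li lj; rewrite !psi_expmxX// => li lj.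
  have : expR 1 * (expR 1 ^+ i * psi xi) <= expR 1 ^+ j * psi xi.
    rewrite mulrA -exprS; apply: ler_wpM2r; first exact: psi_ge0.
    by apply: ler_weXn2l => //; rewrite ltW// expR_gt1.
  rewrite leNgt => /negP[]; apply: (lt_trans lj).
  have -> : l * expR (1 / 2) = expR 1 * (l * expR (- (1 / 2))).
    rewrite mulrCA -expRD; congr (_ * expR _); lra.
  by rewrite ltr_pM2l ?expR_gt0.
pose f (k : nat) xi :=
  ((\1_((fun xi => (M ^+ k)^T *m xi) @^-1` B) xi : R) * dens x xi)%:E.
have mf k : measurable_fun setT (f k) by exact: measurable_mass_integrand.
have f0 k xi : (0 <= f k xi)%E by exact: mass_integrand_ge0.
have mfo (k : 'I_m) : measurable_fun setT (f k) by exact: mf.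
rewrite -[X in (X <= _)%E](ge0_integral_sum _ measurableT mfo (fun k xi _ => f0 k xi)).
apply: (ge0_le_integral _ measurableT).
- by move=> xi _; apply: sume_ge0 => k _; exact: f0.
- by apply: emeasurable_sum => k _; exact: mf.
- exact: measurable_mass_integrand.
move=> xi _; rewrite sumEFin lee_fin -mulr_suml; apply: ler_wpM2r.
  exact: density_ge0.
rewrite indicT.
have [[k0 Bk0]|noB] := pselect (exists k : 'I_m, B ((M ^+ k)^T *m xi)).
  rewrite (bigD1 k0)//= big1 => [|k kk0].
    by rewrite addr0 indicE lern1 leq_b1.
  rewrite indicE memNset//= => Bk; case/eqP: kk0; apply/val_inj.
  have [kk|kk] := leqP k k0; first exact: disj Bk Bk0 kk.
  exact/esym/(disj _ _ _ Bk0 Bk)/ltnW.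
rewrite big1// => k _; rewrite indicE memNset//= => Bk.
by apply: noB; exists k.
Qed.

(** The left eigenvector of [exp_eigenvector], applied to the transpose of [E]. *)
Lemma exp_right_eigenvector z : ceigenvalue E z ->
  exists (v : 'cV[R[i]]_n.+1) (mu : R[i]),
    [/\ v != 0, mxC M *m v = mu *: v & normc mu = expR (complex.Re z)].
Proof.
move=> Ez; have ETz : eigenvalue (mxC E^T) z by rewrite mxC_trmx eigenvalue_trmx.
have [w [mu [w0 wM mue]]] := exp_eigenvector ETz.
exists w^T, mu; split=> //.
  by apply: contra_neq w0 => /(congr1 trmx); rewrite trmxK trmx0.
by rewrite -linearZ/= -wM expmx_trmx mxC_trmx trmx_mul trmxK.
Qed.

(** The left-hand side is the pairing of M^-k v with [xi], written with the real
and imaginary parts of M^-k v, which are points of the real space. *)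
Lemma cdot_invmx_expr (v : 'cV[R[i]]_n.+1) mu k xi : mu != 0 -> mxC M *m v = mu *: v ->
  (dotv (invmx M ^+ k *m Rev v) xi +i* dotv (invmx M ^+ k *m Imv v) xi)%C =
  mu^-1 ^+ k * cdot v xi.
Proof.
move=> mu0 Mv; rewrite -cdot_mulmx -cdotZ; congr cdot.
have Mu : mxC M \in unitmx by rewrite /mxC map_unitmx expmx_unitmx.
have iMv : mxC (invmx M) *m v = mu^-1 *: v.
  apply: (can_inj (mulKmx Mu)); rewrite mulmxA -mxCM mulmxV ?expmx_unitmx//.
  by rewrite mxC1 mul1mx -scalemxAr Mv scalerA mulVf// scale1r.
elim: k => [|k IHk]; first by rewrite !expr0 mxC1 mul1mx scale1r.
rewrite exprS -mulmxE mxCM.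
by rewrite -mulmxA IHk -scalemxAr iMv scalerA -exprSr.
Qed.

End lower_bounds.

Section eigenvalue_bound.
Variables (R : realType) (n : nat) (E : 'M[R]_n.+1) (psi : 'cV[R]_n.+1 -> R).
Variables (alpha H : R).
Hypotheses (psi_ge0 : forall x, 0 <= psi x) (psi_cont : continuous psi).
Hypothesis (psi_homog : mx_homogeneous E^T psi).
Hypothesis (psi_neq0 : forall x, x != 0 -> psi x != 0).
Hypothesis (alpha0 : 0 < alpha).
Local Notation normc := Normc.normc.
Local Notation M := (expmx E).
Local Notation dens := (density E psi alpha H).
Local Notation mass := (mass E psi alpha H).

(** If H >= Re z, every preimage of a window under the powers of exp(E)^T
contributes at least a fixed amount to the sum of the masses at Re v and Im v,
which is then infinite. Two real points are needed: at each k only one of the two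
pairings, which depends on k and xi, is known to be comparable with |mu|^-k. *)
Lemma finite_mass_lt z : ceigenvalue E z -> 0 < complex.Re z ->
  (forall x, (mass setT x < +oo)%E) -> H < complex.Re z.
Proof.
move=> /exp_right_eigenvector[v [mu [v0 Mv mue]]] + fin; set a := complex.Re z => a0.
rewrite ltNge; apply/negP => aH.
have mu0 : mu != 0.
  by apply/eqP => mu0; move: mue; rewrite mu0 Normc.normc0 => /esym/eqP; rewrite gt_eqF// expR_gt0.
have [zc [e [l [kappa [e0 k0 hz]]]]] :=
  exists_window psi_ge0 psi_cont psi_neq0 (- H - \tr E / alpha) v0.
pose x := Rev v; pose y := Imv v; pose B := cube zc e.
pose c (k : nat) := (expR (- a) ^+ k * (1 / 16) * kappa) `^ alpha.
have c0 k : 0 <= c k by exact: powR_ge0.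
have hc k xi : B xi -> c k <= dens (invmx M ^+ k *m x) xi + dens (invmx M ^+ k *m y) xi.
  move=> /hz[/andP[g1 g2] _ kp].
  set u := dotv (invmx M ^+ k *m x) xi; set w := dotv (invmx M ^+ k *m y) xi.
  pose t := expR (- a) ^+ k.
  have t0 : 0 < t by rewrite exprn_gt0// expR_gt0.
  have t1 : t <= 1 by rewrite exprn_ile1 ?expR_ge0// ltW// expR_lt1 oppr_lt0.
  have uw : normc (u +i* w)%C = t * normc (cdot v xi).
    rewrite (cdot_invmx_expr _ _ mu0 Mv) Normc.normcM; congr (_ * _).
    rewrite (_ : normc (mu^-1 ^+ k) = normc mu^-1 ^+ k); last first.
      by elim: (k) => [|j IHj]; rewrite ?expr0 ?Normc.normc1// !exprS Normc.normcM IHj.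
    by rewrite Normc.normcV mue -expRN.
  have uw1 : normc (u +i* w)%C <= 1 by rewrite uw mulr_ile1 ?normc_ge0// ltW.
  have uw4 : t / 4 <= normc (u +i* w)%C.
    by rewrite uw; apply: ler_wpM2l; [exact: ltW | lra].
  have t16 : 0 <= t * (1 / 16) by rewrite mulr_ge0 ?ltW//; lra.
  (* As the modulus is at least t / 4, one of the two real pairings s satisfies
     |s| >= t / 8. *)
  have half s : `|s| <= 1 -> t / 8 <= `|s| -> t * (1 / 16) <= normc (cexpi s - 1).
    move=> s1 st; apply: le_trans (normc_cexpiB1_ge s1).
    lra.
  have := normc_le_sum u w => uwsum.
  have [ut|ut] := leP (t / 8) `|u|.
    have ux := half u (le_trans (normr_Re_le u w) uw1) ut.
    have dx := density_ge alpha0 t16 (ltW k0) ux kp.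
    by apply: (le_trans dx); rewrite lerDl density_ge0.
  have wt : t / 8 <= `|w| by lra.
  have wx := half w (le_trans (normr_Im_le u w) uw1) wt.
  have dx := density_ge alpha0 t16 (ltW k0) wx kp.
  by apply: (le_trans dx); rewrite lerDr density_ge0.
have mB : measurable B by exact: measurable_cube.
pose gam := c 0 * (e *+ 2) ^+ n.+1.
have gam0 : 0 < gam.
  rewrite mulr_gt0 ?exprn_gt0 ?pmulrn_lgt0//.
  by rewrite /c expr0 powR_gt0// mulr_gt0//; lra.
(* This is where a <= H enters: e^(alpha H k) compensates e^(- alpha a k). *)
have cS k : c 0 <= expR (alpha * H) ^+ k * c k.
  rewrite /c expr0 -!mulrA mul1r (@powRM _ (expR (- a) ^+ k)).
  - rewrite [leRHS]mulrA ler_peMl ?powR_ge0// powR_exprn ?expR_ge0// powR_expR -exprMn -expRD.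
    apply: exprn_ege1; rewrite -expR0 ler_expR mulrN -mulrBr mulr_ge0 ?subr_ge0// ltW//.
  - by rewrite exprn_ge0// expR_ge0.
  - by rewrite mulr_ge0 ?ltW//; lra.
have step k : (gam%:E <= mass ((fun xi => (M ^+ k)^T *m xi) @^-1` B) x +
    mass ((fun xi => (M ^+ k)^T *m xi) @^-1` B) y)%E.
  rewrite !(mass_inner H psi_ge0 psi_cont psi_homog alpha0 k _ mB).
  rewrite -ge0_muleDr ?mass_ge0//.
  have h := mass_add_ge psi_cont e0 (c0 k) (hc k).
  have Ek0 : 0 <= expR (alpha * H) ^+ k by rewrite exprn_ge0// expR_ge0.
  have Ek0' : (0 <= (expR (alpha * H) ^+ k)%:E)%E by rewrite lee_fin.
  apply: le_trans (lee_wpmul2l Ek0' h).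
  rewrite -EFinM lee_fin mulrA; apply: ler_wpM2r; last exact: cS.
  by rewrite exprn_ge0// mulrn_wge0// ltW.
have nB0 : ~ B 0.
  move=> /hz[/andP[+ _] _ _]; rewrite /cdot !dotv0 Normc.normc0; lra.
have Bpsi xi : B xi -> l * expR (- (1 / 2)) < psi xi < l * expR (1 / 2).
  by move=> /hz[].
have bound m : ((m%:R * gam)%:E <= mass setT x + mass setT y)%E.
  have hx := mass_disjoint_shells alpha H psi_ge0 psi_cont psi_homog m x mB nB0 Bpsi.
  have hy := mass_disjoint_shells alpha H psi_ge0 psi_cont psi_homog m y mB nB0 Bpsi.
  apply: le_trans (leeD hx hy); rewrite -big_split/=.
  have -> : (m%:R * gam)%:E = (\sum_(k < m) gam%:E)%E.
    by rewrite sumEFin sumr_const card_ord mulr_natl.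
  exact: lee_sum.
have ffin : (mass setT x + mass setT y \is a fin_num)%E.
  rewrite ge0_fin_numE; first exact: (lte_add_pinfty (fin x) (fin y)).
  by apply: adde_ge0; exact: mass_ge0.
move: bound; rewrite -(fineK ffin); set F := fine _ => bound.
have := bound (Num.truncn (F / gam)).+1; rewrite lee_fin leNgt => /negP; apply.
rewrite -ltr_pdivrMr//; exact: truncnS_gt.
Qed.

End eigenvalue_bound.

(** * Increments of the field and stochastic continuity *)

Section convergence_in_probability.
Variables (R : realType) (dT : measure_display) (T : measurableType dT).
Variables (P : probability T R) (n : nat).

Lemma cvg_probability0 (A : 'cV[R]_n -> set T) (x0 : 'cV[R]_n) :
  (forall x, measurable (A x)) ->
  P (A x) @[x --> x0] --> 0%E <->
  (forall e : R, 0 < e -> \forall x \near x0, (P (A x) <= e%:E)%E).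
Proof.
move=> mA; have Pf x : P (A x) \is a fin_num by rewrite fin_num_measure.
have Ff : Filter (nbhs x0) by exact: nbhs_filter.
split=> [/fine_cvgP[_ /(@cvgrPdist_le _ _ _ _ _) h] e e0|h].
  apply: filterS (h e e0) => x; rewrite -[X in (X <= _)%E](fineK (Pf x)) lee_fin.
  by rewrite sub0r normrN; apply: le_trans; exact: ler_norm.
apply/fine_cvgP; split; first exact: filterE.
apply/(@cvgrPdist_le _ _ _ _ _) => e e0; apply: filterS (h e e0) => x.
rewrite -[X in (X <= _)%E](fineK (Pf x)) lee_fin sub0r normrN ger0_norm//.
by rewrite fine_ge0.
Qed.

Lemma measure_ae_eq (A B : set T) : measurable A -> measurable B ->
  {ae P, forall w, A w <-> B w} -> P A = P B.
Proof.
move=> mA mB [N [mN N0 AB]].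
have le (A' B' : set T) : measurable A' -> measurable B' ->
    (forall w, ~ N w -> A' w -> B' w) -> (P A' <= P B')%E.
  move=> mA' mB' h; rewrite -(measureU0 (A := B') _ mN)//.
  apply: le_measure; rewrite ?inE//; first exact: measurableU.
  move=> w Aw; have [|] := pselect (N w); [by right | by move=> Nw; left; exact: h].
have key w : ~ N w -> A w <-> B w by move=> Nw; apply: contrapT => h; exact/Nw/AB.
by apply/eqP; rewrite eq_le !le// => w /key[].
Qed.

End convergence_in_probability.

Section field.
Variables (R : realType) (n : nat) (E : 'M[R]_n.+1) (psi : 'cV[R]_n.+1 -> R).
Variables (alpha H c0 : R).
Variables (dT : measure_display) (T : measurableType dT) (P : probability T R).
Variables (W : set 'cV[R]_n.+1 -> T -> R[i]).
Variables (dom : ('cV[R]_n.+1 -> R[i]) -> Prop).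
Variables (I : ('cV[R]_n.+1 -> R[i]) -> T -> R[i]).
Hypotheses (psi_ge0 : forall x, 0 <= psi x) (psi_cont : continuous psi).
Hypothesis (psi_homog : mx_homogeneous E^T psi).
Hypothesis (psi_neq0 : forall x, x != 0 -> psi x != 0).
Hypotheses (alpha0 : 0 < alpha) (c0_gt0 : 0 < c0).
Hypothesis (I_integral : stable_integral P alpha c0 W dom I).
Local Notation normc := Normc.normc.
Local Notation M := (expmx E).
Local Notation kern := (harmonizable_kernel E psi alpha H).
Local Notation X := (harmonizable_field E psi alpha H I).
Local Notation mass := (mass E psi alpha H).

Lemma dom_kernelP x : dom (kern x) <-> (mass setT x < +oo)%E.
Proof.
rewrite mass_setT; apply: (si_exists I_integral).
exact: cmeasurable_harmonizable_kernel.
Qed.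

Lemma normc_cexpiB (u w : R) : normc (cexpi u - cexpi w) = normc (cexpi (u - w) - 1).
Proof.
have -> : cexpi u - cexpi w = cexpi w * (cexpi (u - w) - 1).
  apply/eqP; rewrite /cexpi eq_complex/=; apply/andP; split; apply/eqP.
    rewrite -[in LHS](subrK w u) (cosD (u - w)); ring.
  rewrite -[in LHS](subrK w u) (sinD (u - w)); ring.
rewrite Normc.normcM (_ : normc (cexpi w) = 1) ?mul1r//.
by rewrite /= cos2Dsin2 sqrtr1.
Qed.

Let increment x y xi : R[i] := 1 * kern x xi + (- 1) * kern y xi.

(** Increments have the same scale parameter as values of the field at
differences, as for any field with stationary increments. *)
Lemma normc_increment x y xi :
  normc (increment x y xi) `^ alpha = density E psi alpha H (x - y) xi.
Proof.
rewrite -normc_harmonizable_kernel /increment /harmonizable_kernel mul1r mulN1r.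
rewrite -mulrBl opprB addrA subrK !Normc.normcM.
by rewrite normc_cexpiB dotvBl.
Qed.

Hypothesis fin : forall x, (mass setT x < +oo)%E.

Lemma cmeasurable_increment x y : cmeasurable (increment x y).
Proof.
have [mx1 mx2] := cmeasurable_harmonizable_kernel E alpha H psi_cont x.
have [my1 my2] := cmeasurable_harmonizable_kernel E alpha H psi_cont y.
have -> : increment x y = fun xi => kern x xi - kern y xi.
  by apply/funext => xi; rewrite /increment mul1r mulN1r.
split.
- rewrite (_ : (fun _ => _) = fun xi => complex.Re (kern x xi) - complex.Re (kern y xi)).
    exact: measurable_funB.
  by apply/funext => xi; case: (kern x xi) (kern y xi) => a b [c d].
- rewrite (_ : (fun _ => _) = fun xi => complex.Im (kern x xi) - complex.Im (kern y xi)).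
    exact: measurable_funB.
  by apply/funext => xi; case: (kern x xi) (kern y xi) => a b [c d].
Qed.

Lemma abs_power_increment x y :
  abs_power_integral alpha (increment x y) = mass setT (x - y).
Proof.
rewrite mass_setT; apply: eq_integral => xi _.
by rewrite normc_increment normc_harmonizable_kernel.
Qed.

Lemma dom_increment x y : dom (increment x y).
Proof.
apply/(si_exists I_integral); first exact: cmeasurable_increment.
by rewrite abs_power_increment.
Qed.

Let Y x y w : R := complex.Re (I (increment x y) w).

Lemma measurable_field x : measurable_fun setT (X x).
Proof. by have [] := si_measurable I_integral ((dom_kernelP x).2 (fin x)). Qed.

Lemma measurable_Y x y : measurable_fun setT (Y x y).
Proof. by have [] := si_measurable I_integral (dom_increment x y). Qed.

Lemma measurable_increment_gt e x y :
  measurable [set w | e < `|X x w - X y w|].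
Proof.
apply: measurable_absY; apply: measurable_funB; exact: measurable_field.
Qed.

Lemma increment_prob e x y :
  P [set w | e < `|X x w - X y w|] = P [set w | e < `|Y x y w|].
Proof.
apply: measure_ae_eq.
- exact: measurable_increment_gt.
- exact/measurable_absY/measurable_Y.
have := si_linear I_integral 1 (- 1) ((dom_kernelP x).2 (fin x)) ((dom_kernelP y).2 (fin y)).
apply: filterS => w h /=.
suff -> : X x w - X y w = Y x y w by [].
rewrite /Y h mul1r mulN1r /harmonizable_field.
by case: (I (kern x) w) (I (kern y) w) => a b [c d].
Qed.

Lemma Re_charfun_increment x y t : complex.Re (charfun P (Y x y) t) =
  expR (- (c0 * `|t| `^ alpha * fine (mass setT (x - y)))).
Proof.
by rewrite (si_charfun I_integral (dom_increment x y)) abs_power_increment.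
Qed.

(** Since 1 - e^(- s) <= s, the concentration inequality becomes linear in the
mass. *)
Lemma increment_le e g x y : 0 < e -> (mass setT (x - y) <= g%:E)%E ->
  (P [set w | (e < `|X x w - X y w|)%R] <= (2 * (c0 * (2 / e) `^ alpha * g))%:E)%E.
Proof.
move=> e0 xyg; set s := c0 * _ * g.
have m0 := mass_ge0 E psi alpha H setT (x - y).
have fg : fine (mass setT (x - y)) <= g.
  by rewrite -lee_fin fineK// ge0_fin_numE.
have f0 : 0 <= fine (mass setT (x - y)) by rewrite fine_ge0.
rewrite increment_prob; apply: (@le_trans _ _ (2 * (1 - expR (- s)))%:E).
  apply: (concentration_charfun (measurable_Y x y) e0) => t /andP[t0 te].
  rewrite Re_charfun_increment ler_expR lerN2 ger0_norm//.
  apply: ler_pM => //; first by rewrite mulr_ge0 ?powR_ge0// ltW.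
  apply: ler_wpM2l; first exact: ltW.
  by rewrite (ge0_ler_powR (ltW alpha0))// nnegrE// divr_ge0 ?ltW.
by rewrite lee_fin ler_pM2l//; have := expR_ge1Dx (- s); lra.
Qed.

Lemma increment_ge e x y : 0 <= e ->
  ((1 - expR (- (c0 * fine (mass setT (x - y)))))%:E <=
   e%:E + 2%:E * P [set w | (e < `|X x w - X y w|)%R])%E.
Proof.
move=> e0; have := charfun_concentration P (measurable_Y x y) e0.
by rewrite Re_charfun_increment normr1 powR1 mulr1 increment_prob.
Qed.

Lemma small_mass_stochastically_continuous :
  (forall e, 0 < e -> exists2 d, 0 < d & forall x, `|x| <= d -> (mass setT x <= e%:E)%E) ->
  stochastically_continuous P X.
Proof.
move=> small x0 e e0.
apply/(cvg_probability0 P _ (fun x => measurable_increment_gt e x x0)) => eps eps0.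
pose L := 2 * (c0 * (2 / e) `^ alpha).
have L0 : 0 < L by rewrite !mulr_gt0 ?powR_gt0 ?divr_gt0.
have [d d0 hd] := small _ (divr_gt0 eps0 L0).
apply/nbhs_ballP; exists d => //= x; rewrite -ball_normE/= => xd.
have xm : (mass setT (x - x0) <= (eps / L)%:E)%E by apply: hd; rewrite distrC ltW.
apply: (le_trans (increment_le e0 xm)).
by rewrite lee_fin mulrA -/L mulrC divfK ?gt_eqF.
Qed.

(** When H <= 0, the points M^-k x tend to 0 but their masses are at least that of
[x]; the characteristic function at 1 of the increment from 0 then stays away from
1. *)
Lemma stochastically_continuous_exponent_gt0 C b : 0 < b ->
  (forall k, `|invmx M ^+ k| <= C * expR (- b) ^+ k) ->
  stochastically_continuous P X -> 0 < H.
Proof.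
move=> b0 decay cX; rewrite ltNge; apply/negP => H0.
pose x : 'cV[R]_n.+1 := const_mx 1.
have x0 : x != 0 by apply/eqP => /colP/(_ ord0)/eqP; rewrite !mxE oner_eq0.
have mx0 := mass_setT_gt0 E H psi_ge0 psi_cont psi_neq0 alpha0 x0.
pose g := fine (mass setT x).
have gE : mass setT x = g%:E by rewrite fineK// ge0_fin_numE ?mass_ge0.
have g0 : 0 < g by rewrite -lte_fin -gE.
pose eta := 1 - expR (- (c0 * g)).
have eta0 : 0 < eta by rewrite subr_gt0 expR_lt1 oppr_lt0 mulr_gt0.
have e0 : 0 < eta / 4 by rewrite divr_gt0.
have := cX 0 _ e0.
move=> /(cvg_probability0 P _ (fun x => measurable_increment_gt (eta / 4) x 0)).
move=> /(_ _ e0)/nbhs_ballP[d /= d0 hd].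
have r01 : 0 <= expR (- b) < 1 by rewrite expR_ge0/= expR_lt1 oppr_lt0.
have C0 : 0 <= C by have := le_trans (normr_ge0 _) (decay 0); rewrite expr0 mulr1.
have D0 : 0 <= n.+1%:R * C * `|x| by rewrite !mulr_ge0.
have [k hk] := exists_expr_lt D0 r01 d0.
pose y := invmx M ^+ k *m x.
have yd : `|y| < d.
  apply: le_lt_trans hk; apply: (le_trans (ler_normM_mulmx _ _)).
  have -> : n.+1%:R * C * `|x| * expR (- b) ^+ k =
    n.+1%:R * (C * expR (- b) ^+ k) * `|x| by ring.
  by apply: ler_wpM2r => //; apply: ler_wpM2l.
have gy : g <= fine (mass setT (y - 0)).
  have := mass_invmx H psi_ge0 psi_cont psi_homog alpha0 k x.
  rewrite subr0 -/y gE; have yE : mass setT y = (fine (mass setT y))%:E.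
    by rewrite fineK// ge0_fin_numE ?mass_ge0.
  rewrite yE -EFinM => -[->]; rewrite ler_piMl ?fine_ge0 ?mass_ge0//.
  rewrite exprn_ile1 ?expR_ge0// -expR0 ler_expR; have := ltW alpha0; nra.
have Py : (P [set w | (eta / 4 < `|X y w - X 0 w|)%R] <= (eta / 4)%:E)%E.
  by apply: hd; rewrite -ball_normE/= sub0r normrN.
have := increment_ge y 0 (ltW e0); rewrite leNgt => /negP; apply.
apply: (@le_lt_trans _ _ (eta / 4 + 2 * (eta / 4))%:E).
  rewrite [leRHS]EFinD; apply: leeD; first exact: lexx.
  by rewrite (EFinM 2); apply: lee_wpmul2l => //; rewrite lee_fin.
apply: (@lt_le_trans _ _ eta%:E); first by rewrite lte_fin; lra.
rewrite lee_fin; apply: lerB; first exact: lexx.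
by rewrite ler_expR lerN2; apply: ler_wpM2l gy; exact: ltW.
Qed.

End field.

(** The result in positive dimension, where square matrices form a nontrivial ring
and polynomials in [E] can be evaluated. *)
Lemma harmonizable_field_succ (R : realType) (n : nat) (E : 'M[R]_n.+1) (a1 : R)
    (psi : 'cV[R]_n.+1 -> R) (alpha H c0 : R)
    (dT : measure_display) (T : measurableType dT) (P : probability T R)
    (W : set 'cV[R]_n.+1 -> T -> R[i])
    (dom : ('cV[R]_n.+1 -> R[i]) -> Prop)
    (I : ('cV[R]_n.+1 -> R[i]) -> T -> R[i])
    (E_pos : forall z : R[i], ceigenvalue E z -> 0 < complex.Re z)
    (a1_smallest : smallest_re_eigenvalue E a1)
    (psi_ge0 : forall x, 0 <= psi x)
    (psi_cont : continuous psi)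
    (psi_homog : mx_homogeneous E^T psi)
    (psi_neq0 : forall x, x != 0 -> psi x != 0)
    (alpha0 : 0 < alpha)
    (c0_gt0 : 0 < c0)
    (I_integral : stable_integral P alpha c0 W dom I) :
  ((forall x, dom (harmonizable_kernel E psi alpha H x)) /\
   stochastically_continuous P (harmonizable_field E psi alpha H I)) <->
  (0 < H < a1).
Proof.
have [[z1 Ez1 z1a] a1_min] := a1_smallest.
have a1_gt0 : 0 < a1 by rewrite -z1a; exact: E_pos.
have domP := dom_kernelP E H psi_cont I_integral.
split=> [[domX cX]|/andP[H0 Ha]].
  have fin x := (domP x).1 (domX x).
  apply/andP; split.
    have b0 : 0 < a1 / 2 by rewrite divr_gt0.
    have [|C decay] := @expmx_inv_norm_decay _ _ E a1 (a1 / 2) a1_min; first by lra.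
    exact: (stochastically_continuous_exponent_gt0 psi_ge0 psi_cont psi_homog
      psi_neq0 alpha0 c0_gt0 I_integral fin b0 decay cX).
  rewrite -z1a; apply: (finite_mass_lt psi_ge0 psi_cont psi_homog psi_neq0 alpha0 Ez1) => //.
  exact: E_pos.
have [|C decay] := @expmx_inv_norm_decay _ _ E a1 ((H + a1) / 2) a1_min; first by lra.
have Hb : H < (H + a1) / 2 by lra.
have fin := mass_setT_lty psi_ge0 psi_cont psi_homog psi_neq0 alpha0 decay H0 Hb.
split=> [x|]; first exact/domP.
apply: (small_mass_stochastically_continuous psi_cont alpha0 c0_gt0 I_integral fin) => e.
exact: (mass_setT_small psi_ge0 psi_cont psi_homog psi_neq0 alpha0 decay H0 Hb).
Qed.

Theorem theorem4p1 (R : realType) (d : nat) (E : 'M[R]_d) (a1 : R)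
    (psi : 'cV[R]_d -> R) (alpha H c0 : R)
    (dT : measure_display) (T : measurableType dT) (P : probability T R)
    (W : set 'cV[R]_d -> T -> R[i])
    (dom : ('cV[R]_d -> R[i]) -> Prop)
    (I : ('cV[R]_d -> R[i]) -> T -> R[i])
    (E_pos : forall z : R[i], ceigenvalue E z -> 0 < complex.Re z)
    (a1_smallest : smallest_re_eigenvalue E a1)
    (psi_ge0 : forall x, 0 <= psi x)
    (psi_cont : continuous psi)
    (psi_homog : mx_homogeneous E^T psi)
    (psi_neq0 : forall x, x != 0 -> psi x != 0)
    (alpha_range : 0 < alpha <= 2)
    (c0_gt0 : 0 < c0)
    (W_sas : isotropic_sas_random_measure P alpha c0 W)
    (I_integral : stable_integral P alpha c0 W dom I) :
  ((forall x, dom (harmonizable_kernel E psi alpha H x)) /\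
   stochastically_continuous P (harmonizable_field E psi alpha H I)) <->
  (0 < H < a1).
Proof.
case: d => [|n] in E psi W dom I E_pos a1_smallest psi_ge0 psi_cont psi_homog
  psi_neq0 W_sas I_integral *.
  (* Row vectors of length 0 are all zero, so a 0 x 0 matrix has no eigenvalue. *)
  by have [[z /eigenvalueP[v _]]] := a1_smallest; rewrite thinmx0 eqxx.
have /andP[alpha0 _] := alpha_range.
exact: (harmonizable_field_succ H E_pos a1_smallest psi_ge0 psi_cont psi_homog
  psi_neq0 alpha0 c0_gt0 I_integral).
Qed.
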